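(* Let $N\ge2$ be an integer, and let $\mu_0,\mu_1\in\mathcal P_2(\mathbb R^d)$ be absolutely continuous with densities in $L^\infty(\mathbb R^d)$. Let $\gamma\in\Gamma(\mu_0,\mu_1)$ be $N$-cyclically monotone and assume that, for the interpolations $\mu_t$ of $\gamma$, $$\min_{w_t\in\mathrm T_{\mu_t}}\mathcal L(w_t|\gamma)=0.$$ Further assume that there exists some $t\in(0,1)$ such that $\mu_t$ is absolutely continuous and (its density satisfies) $\mu_t^{-1}\in L^1_{\mathrm{loc}}(\mathbb R^d)$. Then $\gamma$ is an optimal transport plan between $\mu_0$ and $\mu_1$ (for the quadratic cost $\|x-y\|^2$).
   Context: $\mathcal P_2(\mathbb R^m)$ denotes Borel probability measures with finite second moment, and $\Gamma(\mu_0,\mu_1)$ is the set of $\gamma\in\mathcal P_2(\mathbb R^d\times\mathbb R^d)$ with first marginal $\mu_0$ and second marginal $\mu_1$. Absolute continuity is with respect to Lebesgue measure, and an absolutely continuous measure is identified with its density. A plan $\gamma$ is $N$-cyclically monotone if for all $(x^{(1)},y^{(1)}),\dots,(x^{(N)},y^{(N)})\in\mathrm{supp}(\gamma)$ and all permutations $\tau$ of $\{1,\dots,N\}$, $\sum_{i=1}^N\|x^{(i)}-y^{(i)}\|^2\le\sum_{i=1}^N\|x^{(i)}-y^{(\tau(i))}\|^2$. The interpolation $\mu_t$ ($t\in[0,1]$) of $\gamma$ is the law of $(1-t)x+ty$ under $\gamma$. The flow matching loss is $\mathcal L(w_t|\gamma)=\int_0^1\int\|w_t((1-t)x+ty)-y+x\|^2\,d\gamma(x,y)\,dt$,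 for Borel vector fields $w:(t,x)\mapsto w_t(x)\in\mathbb R^d$ with $\int_0^1\int\|w_t\|^2d\mu_t\,dt<\infty$. For a measure $\mu$ on $\mathbb R^d$, $\mathrm T_\mu$ is the closure of $\{\nabla\varphi:\varphi\in C_c^\infty(\mathbb R^d)\}$ in $L^2(\mu;\mathbb R^d)$; the minimum over $w_t\in\mathrm T_{\mu_t}$ is over such fields with $w_t\in\mathrm T_{\mu_t}$ for a.e. $t$. *)

(* Defs.v *)
From HB Require Import structures.
From mathcomp Require Import all_boot all_order all_algebra all_fingroup.
From mathcomp Require Import all_classical all_reals all_analysis.
From mathcomp Require Import measurable_realfun.
Import Order.TTheory GRing.Theory Num.Theory.
Import numFieldNormedType.Exports.

Set Implicit Arguments.
Unset Strict Implicit.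
Unset Printing Implicit Defensive.

Local Open Scope classical_set_scope.
Local Open Scope ring_scope.

(* Row vectors 'rV[R]_d play the role of R^d.  Their library norm is the sup
   norm; it is only used here for the topology, the squared Euclidean norm
   being [sqnorm] below. *)

Section borel_matrix.
Variables (R : realType) (m n : nat).
Let G := @open 'M[R]_(m, n).

HB.instance Definition _ := @isMeasurable.Build (sigma_display G)
  'M[R]_(m, n) <<s G >> (@sigma_algebra0 _ setT G) (@sigma_algebraC _ G)
  (@sigma_algebra_bigcup _ setT G).

Lemma open_measurable_mx (U : set 'M[R]_(m, n)) : open U -> measurable U.
Proof. exact: sub_sigma_algebra. Qed.

End borel_matrix.

Lemma measurable_coord (R : realType) n (i : 'I_n) :
  measurable_fun [set: 'rV[R]_n] (fun v : 'rV[R]_n => v 0 i).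
Proof.
apply: (measurability _ (RGenOpens.measurableE R)).
move=> _ [_ [a [b ->]] <-]; rewrite setTI; apply: open_measurable_mx.
apply: open_comp; last exact: interval_open.
by move=> ? _; exact: coord_continuous.
Qed.

Lemma measurable_fun_rV (R : realType) n (d : measure_display)
    (T : measurableType d) (f : T -> 'rV[R]_n) :
  (forall i, measurable_fun [set: T] (fun x => f x 0 i)) ->
  measurable_fun [set: T] f.
Proof.
move=> mf.
apply: (@measurability _ _ _ _ setT f (@open 'rV[R]_n)) => //.
move=> _ [U oU <-]; rewrite setTI.
pose B (p : 'rV[rat]_n * nat) : set 'rV[R]_n :=
  [set v | forall i, `|v 0 i - ratr (p.1 0 i)| < p.2.+1%:R^-1].
have mB p : measurable (f @^-1` B p).
  have -> : f @^-1` B p =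
      \bigcap_(i in [set: 'I_n])
       ((fun x => f x 0 i) @^-1` ball (ratr (p.1 0 i) : R) (p.2.+1%:R^-1)).
    apply/seteqP; split=> [x Bx i _|x Bx i].
      by have := Bx i; rewrite /ball /= distrC.
    by have := Bx i I; rewrite /= /ball /= distrC.
  apply: fin_bigcap_measurable => // i _.
  rewrite -[X in measurable X]setTI; apply: mf => //.
  by apply: open_measurable; apply: ball_open; rewrite ?invr_gt0.
have -> : f @^-1` U =
    \bigcup_(p : 'rV[rat]_n * nat)
      (if `[< B p `<=` U >] then f @^-1` B p else set0).
  apply/seteqP; split=> [x /= Ux|x [p _]]; last first.
    by case: ifPn => // /asboolP BU Bx; exact: BU.
  have : nbhs (f x) U by exact: open_nbhs_nbhs.
  move=> /nbhs_ballP[e /= e0 eU].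
  have [k ke] : exists k : nat, k.+1%:R^-1 < e / 2 :> R.
    have e20 : 0 < e / 2 by rewrite divr_gt0.
    have [k _ /(_ k (leqnn k)) kP] := near_infty_natSinv_lt (PosNum e20).
    by exists k.
  have /choice[q qP] : forall i, exists q : rat,
      `|f x 0 i - ratr q| < k.+1%:R^-1 :> R.
    move=> i; have [|q] := @rat_in_itvoo R (f x 0 i - k.+1%:R^-1)
      (f x 0 i + k.+1%:R^-1).
      by rewrite ltrD2l gtrN// invr_gt0.
    rewrite in_itv/= => qI; exists q; rewrite distrC ltr_distl.
    exact: qI.
  exists (\row_i q i, k) => //=.
  rewrite ifT; first by move=> i; rewrite mxE; exact: qP.
  apply/asboolP.
  move=> v vB; apply: eU; split=> // i j; rewrite (ord1 i).
  rewrite /ball/= (le_lt_trans (ler_distD (ratr (q j)) _ _))//.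
  rewrite [ltRHS]splitr ltrD//; first exact: lt_trans (qP j) ke.
  by rewrite distrC (lt_trans _ ke)//; have := vB j; rewrite mxE.
apply: countable_bigcupT_measurable => // p.
by case: ifPn.
Qed.

(* The Lebesgue measure on R^d, by induction on the dimension: on R^0 it is the
   unit mass, on R^(1 + n) it is the image of the product measure by the
   concatenation of vectors. *)
Section lebesgue.
Variable R : realType.

Definition rV_cons n (p : 'rV[R]_n * measurableTypeR R) : 'rV[R]_n.+1 :=
  row_mx (const_mx p.2 : 'rV[R]_1) p.1.

Lemma rV_cons0 n p : @rV_cons n p 0 ord0 = p.2.
Proof.
have -> : ord0 = @lshift 1 n ord0 :> 'I_n.+1 by exact/val_inj.
by rewrite (@row_mxEl _ 1 1 n) mxE.
Qed.

Lemma rV_consS n p (i : 'I_n) : @rV_cons n p 0 (lift ord0 i) = p.1 0 i.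
Proof.
have -> : lift ord0 i = @rshift 1 n i :> 'I_n.+1 by exact/val_inj.
by rewrite (@row_mxEr _ 1 1 n).
Qed.

Lemma measurable_rV_cons n : measurable_fun [set: _] (@rV_cons n).
Proof.
apply: measurable_fun_rV => i; case: (unliftP ord0 i) => [j|] ->.
  rewrite [X in measurable_fun _ X](_ : _ = (fun v : 'rV[R]_n => v 0 j) \o fst).
    exact: measurableT_comp (measurable_coord j) measurable_fst.
  by apply/funext => p; rewrite rV_consS.
rewrite [X in measurable_fun _ X](_ : _ = snd); first exact: measurable_snd.
by apply/funext => p; rewrite rV_cons0.
Qed.

HB.instance Definition _ n :=
  isMeasurableFun.Build _ _ _ _ (@rV_cons n) (@measurable_rV_cons n).

Section step.
Variables (n : nat) (mu : {measure set 'rV[R]_n -> \bar R}).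
Local Open Scope ereal_scope.

Definition lebesgue_step : set 'rV[R]_n.+1 -> \bar R :=
  pushforward (mu \x @lebesgue_measure R) (@rV_cons n).

Let step0 : lebesgue_step set0 = 0. Proof. exact: measure0. Qed.

Let step_ge0 A : 0 <= lebesgue_step A. Proof. exact: measure_ge0. Qed.

Let step_sigma_additive : semi_sigma_additive lebesgue_step.
Proof. exact: measure_semi_sigma_additive. Qed.

HB.instance Definition _ := isMeasure.Build _ _ _ lebesgue_step
  step0 step_ge0 step_sigma_additive.

End step.

Fixpoint leb (d : nat) : {measure set 'rV[R]_d -> \bar R} :=
  match d with
  | 0 => \d_(0 : 'rV[R]_0)
  | d'.+1 => lebesgue_step (leb d')
  end.

Lemma leb_box d (A : 'I_d -> set (measurableTypeR R)) :
  (forall i, measurable (A i)) ->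
  leb d [set v | forall i, A i (v 0 i)] =
  (\prod_(i < d) @lebesgue_measure R (A i))%E.
Proof.
elim: d A => [A _|d IH A mA].
  by rewrite big_ord0 /= diracE mem_set//= => -[].
rewrite /= /lebesgue_step /pushforward.
have -> : @rV_cons d @^-1` [set v | forall i, A i (v 0 i)] =
    [set v : 'rV[R]_d | forall i, A (lift ord0 i) (v 0 i)] `*` A ord0.
  apply/seteqP; split => [p /= H|p /= [H0 HS] i].
    split => [i|]; first by rewrite -rV_consS.
    by rewrite /= -rV_cons0.
  by case: (unliftP ord0 i) => [j|] ->; rewrite ?rV_consS ?rV_cons0.
rewrite product_measure1E//; last first.
  rewrite (_ : mkset _ = \bigcap_(i in [set: 'I_d])
      ((fun v : 'rV[R]_d => v 0 i) @^-1` A (lift ord0 i))).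
    apply: fin_bigcap_measurable => // i _; rewrite -[X in measurable X]setTI.
    exact: (measurable_coord i measurableT (mA (lift ord0 i))).
  by apply/seteqP; split=> v /= H i; [move=> _; exact: H|exact: H].
rewrite big_ord_recl muleC; congr (_ * _)%E.
exact: (IH (fun i => A (lift ord0 i))).
Qed.

End lebesgue.

Section euclidean.
Variables (R : realType) (d : nat).

Definition sqnorm (v : 'rV[R]_d) : R := \sum_(i < d) v 0 i ^+ 2.

Fixpoint iter_partial (s : seq 'I_d) (phi : 'rV[R]_d -> R) : 'rV[R]_d -> R :=
  if s is i :: s' then 'D_(delta_mx 0 i) (iter_partial s' phi) else phi.

Definition smooth (phi : 'rV[R]_d -> R) :=
  forall s : seq 'I_d, continuous (iter_partial s phi) /\
    forall x i, derivable (iter_partial s phi) x (delta_mx 0 i).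

Definition test_function (phi : 'rV[R]_d -> R) :=
  smooth phi /\ compact (closure [set x | phi x != 0]).

Definition gradient (phi : 'rV[R]_d -> R) (x : 'rV[R]_d) : 'rV[R]_d :=
  \row_i 'D_(delta_mx 0 i) phi x.

End euclidean.

Section measures.
Variables (R : realType) (d : nat).
Local Notation E := 'rV[R]_d.
Local Open Scope ereal_scope.

Definition P2 (mu : probability E R) :=
  \int[mu]_x (sqnorm x)%:E < +oo.

(* Densities are everywhere defined representatives; any two of them agree
   almost everywhere, so that it does not matter below which one is taken. *)
Definition is_density (mu : set E -> \bar R) (rho : E -> R) :=
  [/\ measurable_fun [set: E] rho, (forall x, (0 <= rho x)%R) &
    forall A, measurable A -> mu A = \int[leb R d]_(x in A) (rho x)%:E].

Definition ac_Linfty (mu : set E -> \bar R) :=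
  mu `<< leb R d /\
  exists2 rho, is_density mu rho & 'N[leb R d]_+oo[EFin \o rho] < +oo.

(* The inverse is that of \bar R, so that 1 / rho is +oo where rho vanishes. *)
Definition ac_inv_L1loc (mu : set E -> \bar R) :=
  mu `<< leb R d /\
  exists2 rho, is_density mu rho &
    forall K : set E, compact K -> \int[leb R d]_(x in K) ((rho x)%:E)^-1 < +oo.

Definition L2 (mu : set E -> \bar R) (w : E -> E) :=
  measurable_fun [set: E] w /\ \int[mu]_x (sqnorm (w x))%:E < +oo.

Definition tangent (mu : set E -> \bar R) (w : E -> E) :=
  L2 mu w /\ forall eps : R, (0 < eps)%R -> exists2 phi, test_function phi &
    \int[mu]_x (sqnorm (w x - gradient phi x)%R)%:E < (eps ^+ 2)%:E.

End measures.

Section plans.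
Variables (R : realType) (d : nat).
Local Notation E := 'rV[R]_d.
Local Notation EE := ('rV[R]_d * 'rV[R]_d)%type.
Local Open Scope ereal_scope.

(* Marginals are compared on Borel sets only, measures being total functions
   on sets. *)
Definition coupling (mu0 mu1 : probability E R) (gamma : probability EE R) :=
  [/\ \int[gamma]_z (sqnorm z.1 + sqnorm z.2)%:E < +oo,
      forall A, measurable A -> pushforward gamma fst A = mu0 A &
      forall A, measurable A -> pushforward gamma snd A = mu1 A].

Definition cost (gamma : probability EE R) : \bar R :=
  \int[gamma]_z (sqnorm (z.1 - z.2)%R)%:E.

Definition optimal (mu0 mu1 : probability E R) (gamma : probability EE R) :=
  coupling mu0 mu1 gamma /\
  forall gamma', coupling mu0 mu1 gamma' -> cost gamma <= cost gamma'.

Definition supp (gamma : probability EE R) : set EE :=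
  [set z | forall U : set EE, open U -> U z -> 0 < gamma U].

Definition cyclically_monotone (N : nat) (gamma : probability EE R) :=
  forall x y : 'I_N -> E, (forall i, supp gamma (x i, y i)) ->
  forall tau : 'S_N,
    (\sum_(i < N) sqnorm (x i - y i) <=
     \sum_(i < N) sqnorm (x i - y (tau i)))%R.

Definition interpolate (t : R) (z : EE) : E := ((1 - t) *: z.1 + t *: z.2)%R.

Lemma measurable_interpolate t : measurable_fun [set: EE] (interpolate t).
Proof.
apply: measurable_fun_rV => i.
under [X in measurable_fun _ X]eq_fun do rewrite !mxE.
apply: measurable_funD; apply: measurable_funM => //.
  exact: measurableT_comp (measurable_coord i) measurable_fst.
exact: measurableT_comp (measurable_coord i) measurable_snd.
Qed.

HB.instance Definition _ t :=
  isMeasurableFun.Build _ _ _ _ (interpolate t) (measurable_interpolate t).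

Definition interpolation (gamma : probability EE R) (t : R) :
    probability E R :=
  distribution gamma (interpolate t).

Definition loss (w : R -> E -> E) (gamma : probability EE R) : \bar R :=
  \int[@lebesgue_measure R]_(t in `[0%R, 1%R])
    \int[gamma]_z (sqnorm (w t (interpolate t z) - z.2 + z.1)%R)%:E.

Definition velocity_field (gamma : probability EE R) (w : R -> E -> E) :=
  measurable_fun
    (`[0%R, 1%R]%classic `*` [set: E] : set (measurableTypeR R * E))
    (fun p => w p.1 p.2) /\
  \int[@lebesgue_measure R]_(t in `[0%R, 1%R])
    \int[interpolation gamma t]_x (sqnorm (w t x))%:E < +oo.

Definition tangent_field (gamma : probability EE R) (w : R -> E -> E) :=
  velocity_field gamma w /\
  {ae @lebesgue_measure R, forall t, t \in `[0%R, 1%R] ->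
    tangent (interpolation gamma t) (w t)}.

End plans.

Definition is_min (R : realType) (T : Type) (A : set T) (f : T -> \bar R)
    (m : \bar R) :=
  (exists2 a, A a & f a = m) /\ forall a, A a -> (m <= f a)%E.

(* Main.v *)
(* For N >= 2 the support of gamma is a monotone relation, so that for
   0 < s < 1 the interpolation z = (1 - s) x + s y determines (x, y) in the
   support, with a Lipschitz velocity v(z) = y - x. At the time s where
   1 / mu_s is locally integrable, mu_s charges every ball and v is defined on
   the whole of R^d.
   At almost every t the zero loss and w_t in T_{mu_t} give test functions phi
   with grad phi (z + (t - s) v(z)) -> v(z) in L^2(mu_s), hence, 1 / mu_s being
   locally integrable, in L^1_loc of the Lebesgue measure. The increments of
   phi along the images of the edges of a triangle sum to zero; in the limit,
   the circulation of v along triangles vanishes, since the extra terms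
   (t - s) <v, dv> integrate to (t - s) |v|^2 / 2. So v has a potential G.
   By monotonicity of x and y as functions of z,
     - |z' - z|^2 / (2 (1 - s)) <= G(z') - G(z) - <v(z), z' - z>
                                <= |z' - z|^2 / (2 s),
   which says that z attains the extremum in the Hopf-Lax formulas for the
   Kantorovich potentials at x and y: duality concludes. *)
From HB Require Import structures.
Require Import Defs.
From mathcomp Require Import all_boot all_order all_algebra all_fingroup.
From mathcomp Require Import all_classical all_reals all_analysis.
From mathcomp Require Import measurable_realfun ring lra.
Import Order.TTheory GRing.Theory Num.Theory.
Import numFieldNormedType.Exports.
Set Implicit Arguments.
Unset Strict Implicit.
Unset Printing Implicit Defensive.
Local Open Scope classical_set_scope.
Local Open Scope ring_scope.

(** * Euclidean structure and monotone pairs *)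

Section dot.
Variables (R : realType) (d : nat).
Local Notation E := 'rV[R]_d.
Implicit Types (u v w : E) (a b c : R).

Definition dot u v : R := \sum_(i < d) u 0 i * v 0 i.

Lemma dotC u v : dot u v = dot v u.
Proof. by apply: eq_bigr => i _; rewrite mulrC. Qed.

Lemma dotDl u v w : dot (u + v) w = dot u w + dot v w.
Proof. by rewrite -big_split; apply: eq_bigr => i _; rewrite !mxE mulrDl. Qed.

Lemma dotZl a u v : dot (a *: u) v = a * dot u v.
Proof. by rewrite mulr_sumr; apply: eq_bigr => i _; rewrite !mxE mulrA. Qed.

Lemma dotNl u v : dot (- u) v = - dot u v.
Proof. by rewrite -scaleN1r dotZl mulN1r. Qed.

Lemma dotDr u v w : dot w (u + v) = dot w u + dot w v.
Proof. by rewrite dotC dotDl !(dotC w). Qed.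

Lemma dotZr a u v : dot u (a *: v) = a * dot u v.
Proof. by rewrite dotC dotZl (dotC u). Qed.

Lemma dotNr u v : dot u (- v) = - dot u v.
Proof. by rewrite dotC dotNl (dotC u). Qed.

Definition dotE := (dotDl, dotDr, dotNl, dotNr, dotZl, dotZr).

Lemma sqnormE u : sqnorm u = dot u u.
Proof. by apply: eq_bigr => i _; rewrite expr2. Qed.

Lemma sqnorm_ge0 u : 0 <= sqnorm u.
Proof. by apply: sumr_ge0 => i _; exact: sqr_ge0. Qed.

Lemma sqnormB u v : sqnorm (u - v) = sqnorm u - 2 * dot u v + sqnorm v.
Proof. by rewrite !sqnormE !dotE (dotC v u); ring. Qed.

Lemma sqnormB_le u v : sqnorm (u - v) <= 2 * sqnorm u + 2 * sqnorm v.
Proof.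
have := sqnorm_ge0 (u + v); rewrite !sqnormE !dotE (dotC v u); lra.
Qed.

Lemma coord_le_norm u i : `|u 0 i| <= `|u|.
Proof.
rewrite [leRHS]/Num.norm/= mx_normrE; apply/bigmax_geP; right => /=.
by exists (0, i).
Qed.

Lemma norm_le_coord u a : 0 <= a -> (forall i, `|u 0 i| <= a) -> `|u| <= a.
Proof.
move=> a0 ua; rewrite [leLHS]/Num.norm/= mx_normrE; apply/bigmax_leP; split=> //.
by move=> [i j] _ /=; rewrite (ord1 i).
Qed.

Lemma norm_sq_le_sqnorm u : `|u| ^+ 2 <= sqnorm u.
Proof.
rewrite -[leRHS]sqr_sqrtr ?sqnorm_ge0// lerXn2r ?nnegrE ?sqrtr_ge0//.
apply: norm_le_coord => [|i]; first exact: sqrtr_ge0.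
rewrite -sqrtr_sqr ler_wsqrtr// /sqnorm (bigD1 i)//= lerDl.
by apply: sumr_ge0 => j _; exact: sqr_ge0.
Qed.

(** The norm is the sup norm, so each of the [d] products is bounded separately; the dimensional
    constant is harmless in the limits where it occurs. *)
Lemma dot_le_norm u v : `|dot u v| <= d%:R * (`|u| * `|v|).
Proof.
rewrite (le_trans (ler_norm_sum _ _ _))//.
rewrite -[X in X%:R]card_ord -sumr_const mulr_suml ler_sum// => i _.
by rewrite mul1r normrM ler_pM// coord_le_norm.
Qed.

Lemma sqnorm_le_norm u : sqnorm u <= d%:R * `|u| ^+ 2.
Proof. by rewrite sqnormE (le_trans (ler_norm _))// expr2 dot_le_norm. Qed.

End dot.

Section monotone_pairs.
Variables (R : realType) (d : nat).
Local Notation E := 'rV[R]_d.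

Lemma cyclically_monotone_dot N (gamma : probability (E * E)%type R) :
  (2 <= N)%N -> cyclically_monotone N gamma ->
  forall p q, supp gamma p -> supp gamma q ->
  0 <= dot (p.1 - q.1) (p.2 - q.2).
Proof.
move=> N2 cm p q sp sq.
case: N N2 cm => [//|[//|N]] _ cm.
pose i0 : 'I_N.+2 := ord0; pose i1 : 'I_N.+2 := lift ord0 ord0.
(* The family is [q] once and [p] at every other index: the transposition of the first two indices
   gives the two-point inequality, and the remaining terms cancel. *)
pose z i := if i == i0 then q else p.
have := cm (fun i => (z i).1) (fun i => (z i).2) _ (tperm i0 i1).
have sz i : supp gamma ((z i).1, (z i).2).
  by rewrite -surjective_pairing /z; case: ifP.
move=> /(_ sz).
rewrite (bigD1 i0)//= (bigD1 i1)//= [X in _ <= X](bigD1 i0)//=.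
rewrite [X in _ <= _ + X](bigD1 i1)//= tpermL tpermR.
rewrite [X in _ <= _ + (_ + X)](eq_bigr (fun i => sqnorm ((z i).1 - (z i).2))).
  rewrite !addrA lerD2r /z /= !sqnormB !sqnormE !dotE; lra.
by move=> i /andP[i0' i1']; rewrite tpermD// eq_sym.
Qed.

(* [dz] and [dv] are the differences of the positions at time [s] and of the
   velocities: with these bounds the velocity is a Lipschitz function of the
   position, and [z - s v(z)], [z + (1 - s) v(z)] are monotone. *)
Lemma monotone_velocity (s : R) (p q : E * E) : 0 < s -> s < 1 ->
  0 <= dot (p.1 - q.1) (p.2 - q.2) ->
  let dz := interpolate s p - interpolate s q in
  let dv := (p.2 - p.1) - (q.2 - q.1) in
  [/\ (1 - s) ^+ 2 * sqnorm (p.1 - q.1) <= sqnorm dz,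
      s ^+ 2 * sqnorm (p.2 - q.2) <= sqnorm dz,
      s * dot dv dz <= sqnorm dz &
      - ((1 - s) * dot dv dz) <= sqnorm dz].
Proof.
move=> s0 s1 m /=.
have -> : interpolate s p - interpolate s q =
    (1 - s) *: (p.1 - q.1) + s *: (p.2 - q.2).
  by rewrite /interpolate !scalerBr; apply/rowP => i; rewrite !mxE; ring.
have -> : p.2 - p.1 - (q.2 - q.1) = (p.2 - q.2) - (p.1 - q.1).
  by apply/rowP => i; rewrite !mxE; ring.
move: (p.1 - q.1) (p.2 - q.2) m => u v m.
rewrite !sqnormE !dotE (dotC v u).
have := sqnorm_ge0 u; have := sqnorm_ge0 v; rewrite !sqnormE.
move: (dot u u) (dot v v) (dot u v) m => a b c c0.
move=> b0 a0.
have t0 : 0 < 1 - s by lra.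
(* After expansion the four claims are linear in the products below; the gaps in the last two are
   [(1 - s) * a + s * c] and [s * b + (1 - s) * c]. *)
have ? : 0 <= s * c by rewrite mulr_ge0// ltW.
have ? : 0 <= (1 - s) * c by rewrite mulr_ge0// ltW.
have ? : 0 <= s * (1 - s) * c by rewrite !mulr_ge0// ltW.
have ? : 0 <= s * b by rewrite mulr_ge0// ltW.
have ? : 0 <= (1 - s) * a by rewrite mulr_ge0// ltW.
have ? : 0 <= s * s * b by rewrite !mulr_ge0// ltW.
have ? : 0 <= (1 - s) * (1 - s) * a by rewrite !mulr_ge0// ltW.
by split; lra.
Qed.

End monotone_pairs.

(** * Lebesgue measure, densities and supports *)

Section translation.
Variable R : realType.
Local Open Scope ereal_scope.

(** The image of the measure by a translation has the same values on half-open intervals, and these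
    determine it. *)
Lemma lebesgue_measure_translation (c : R) (A : set (measurableTypeR R)) :
  measurable A ->
  @lebesgue_measure R ((fun x => (x + c)%R) @^-1` A) = @lebesgue_measure R A.
Proof.
have mc : measurable_fun [set: measurableTypeR R]
    (fun x : measurableTypeR R => (x + c)%R : measurableTypeR R).
  exact: measurable_funD.
pose HBc := isMeasurableFun.Build _ _ _ _ _ mc.
pose fc : {mfun measurableTypeR R >-> measurableTypeR R} :=
  HB.pack (fun x : measurableTypeR R => (x + c)%R : measurableTypeR R) HBc.
move=> mA; apply/esym.
apply: (@lebesgue_measure_unique R (pushforward (@lebesgue_measure R) fc)) => //.
move=> _ [[a b] _ <-]/=; rewrite /pushforward.
have -> : fc @^-1` [set` `]a, b]%R] = [set` `](a - c), (b - c)]%R].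
  by apply/seteqP; split=> x /=; rewrite !in_itv/= ltrBlDr lerBrDr.
rewrite !lebesgue_measure_itv /= !lte_fin ltrD2r.
by case: ifP => // _; rewrite -!EFinB; congr EFin; ring.
Qed.

Lemma measurable_translation d (c : 'rV[R]_d) :
  measurable_fun [set: 'rV[R]_d] (fun x : 'rV[R]_d => (x + c)%R).
Proof.
apply: measurable_fun_rV => i.
under eq_fun do rewrite mxE.
by apply: measurable_funD => //; exact: measurable_coord.
Qed.

(** Induction on the dimension by slicing: the one-dimensional case translates the first coordinate
    inside each slice, the induction hypothesis the remaining ones. *)
Lemma leb_translation d (c : 'rV[R]_d) (A : set 'rV[R]_d) :
  measurable A -> leb R d ((fun x => (x + c)%R) @^-1` A) = leb R d A.
Proof.
elim: d c A => [|d IH] c A mA.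
  congr (leb R 0 _); apply/funext => x /=; congr A.
  by apply/rowP => -[].
rewrite /= /lebesgue_step /pushforward /product_measure1 /=.
pose c' : 'rV[R]_d := \row_i c 0%R (lift ord0 i).
pose F v := @lebesgue_measure R (xsection (@rV_cons R d @^-1` A) v).
have mB : measurable (@rV_cons R d @^-1` A).
  by rewrite -[X in measurable X]setTI; exact: measurable_rV_cons.
have mF : measurable_fun setT F by exact: measurable_fun_xsection.
transitivity (\int[leb R d]_v F (v + c')%R).
  apply: eq_integral => v _; rewrite /F/=.
  rewrite -[RHS](lebesgue_measure_translation (c 0%R ord0)); last first.
    exact: measurable_xsection.
  congr lebesgue_measure; apply/funext => x /=.
  rewrite /xsection/= !inE/=; congr A; apply/rowP => i.
  case: (unliftP ord0 i) => [j|] ->.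
    by rewrite [LHS]mxE !rV_consS/= [RHS]mxE [X in _ = (_ + X)%R]mxE.
  by rewrite [LHS]mxE !rV_cons0.
have := @ge0_integral_pushforward _ _ _ _ R _ (measurable_translation c')
  (leb R d) setT F measurableT mF.
rewrite preimage_setT => <- //.
apply: eq_measure_integral; first exact: measurable_translation.
by move=> ? B mB' _; exact: IH.
Qed.

Lemma ge0_integral_leb_translation d (c : 'rV[R]_d) (D : set 'rV[R]_d)
    (f : 'rV[R]_d -> \bar R) :
  measurable D -> measurable_fun D f -> (forall x, 0 <= f x) ->
  \int[leb R d]_(x in (fun x => (x + c)%R) @^-1` D) f (x + c)%R =
  \int[leb R d]_(x in D) f x.
Proof.
move=> mD mf f0.
have := @ge0_integral_pushforward _ _ _ _ R _ (measurable_translation c)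
  (leb R d) D f mD mf.
move=> <- //.
apply: eq_measure_integral; first exact: measurable_translation.
by move=> ? B mB' _; exact: leb_translation.
Qed.

End translation.

Section density.
Context dd (T : measurableType dd) (R : realType).
Variables (m mu : {measure set T -> \bar R}) (rho : T -> R).
Hypothesis mrho : measurable_fun [set: T] rho.
Hypothesis rho0 : forall x, 0 <= rho x.
Hypothesis murho : forall A, measurable A ->
  mu A = (\int[m]_(x in A) (rho x)%:E)%E.
Local Open Scope ereal_scope.
Import HBNNSimple.

Let integral_nnsfun_density (f : {nnsfun T >-> R}) :
  \int[mu]_x (f x)%:E = \int[m]_x ((f x)%:E * (rho x)%:E).
Proof.
under [LHS]eq_integral do rewrite fimfunE -fsumEFin//.
rewrite [LHS]ge0_integral_fsum//; last 2 first.
  - by move=> r; exact/measurable_EFinP/measurableT_comp.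
  - by move=> n x _; rewrite EFinM nnfun_muleindic_ge0.
under [RHS]eq_integral.
  move=> x xD; rewrite fimfunE -fsumEFin// muleC ge0_mule_fsumr; last first.
    by move=> r; rewrite EFinM nnfun_muleindic_ge0.
  over.
rewrite [RHS]ge0_integral_fsum//; last 2 first.
  - move=> r; apply/measurable_EFinP; apply: measurable_funM => //; exact: measurable_funM.
  - move=> n x _; rewrite mule_ge0//; first by rewrite lee_fin.
    by rewrite nnfun_muleindic_ge0.
apply: eq_fsbigr => r _.
rewrite integralZl_indic_nnsfun//= integral_indic// setIT murho//.
(* A negative [r] is not a value of [f], and both terms vanish; otherwise the constant [r] can be
   taken out of the integral. *)
case: (ltP r 0%R) => [r0|r0].
  have -> : f @^-1` [set r] = set0.
    by apply/seteqP; split=> x //= fxr; move: r0; rewrite -fxr ltNge fun_ge0.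
  rewrite integral_set0 mule0; under eq_integral do rewrite indic0 mulr0 mule0.
  by rewrite integral0.
rewrite integral_mkcond -ge0_integralZl//; last 2 first.
  - by apply/(measurable_restrictT _ _).1 => //; apply: measurable_funTS; exact/measurable_EFinP.
  - by move=> x _; rewrite patchE; case: ifP => // _; rewrite lee_fin.
apply: eq_integral => x _.
rewrite patchE indicE; case: ifP => _; rewrite ?mulr1 ?mulr0 ?mule0//.
by rewrite muleC.
Qed.

(** The density is given on sets, hence integrates simple functions; monotone convergence along
    simple approximations gives the rest. *)
Lemma ge0_integral_density (f : T -> \bar R) :
  measurable_fun setT f -> (forall x, 0 <= f x) ->
  \int[mu]_x f x = \int[m]_x (f x * (rho x)%:E).
Proof.
move=> mf f0.
pose f_ := nnsfun_approx measurableT mf.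
transitivity (lim (\int[mu]_x (f_ n x)%:E @[n --> \oo])).
  rewrite -monotone_convergence//=.
  - apply: eq_integral => ? /[!inE] xD; apply/esym/cvg_lim => //=.
    exact: cvg_nnsfun_approx.
  - by move=> n; exact/measurable_EFinP/measurable_funTS.
  - by move=> n ? _; rewrite lee_fin.
  - by move=> ? _ ? ? mn; rewrite lee_fin; exact/lefP/nd_nnsfun_approx.
transitivity (lim (\int[m]_x ((f_ n x)%:E * (rho x)%:E) @[n --> \oo])).
  under eq_fun do rewrite integral_nnsfun_density.
  by [].
rewrite -monotone_convergence//=.
- apply: eq_integral => x _; apply/cvg_lim => //=.
  apply: cvgeZr => //.
  exact: cvg_nnsfun_approx.
- by move=> n; apply/measurable_EFinP; exact: measurable_funM.
- by move=> n x _; rewrite mule_ge0// lee_fin.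
- move=> x _ a b ab; rewrite lee_wpmul2r// ?lee_fin//.
  exact/lefP/nd_nnsfun_approx.
Qed.

End density.

Section rational_balls.
Variable R : realType.

(** A countable base of the topology. It makes open sets of the product measurable and the
    complement of a support negligible. *)
Lemma rat_ball_nbhs n (x : 'rV[R]_n) (U : set 'rV[R]_n) : nbhs x U ->
  exists p : 'rV[rat]_n * nat,
    ball (map_mx ratr p.1 : 'rV[R]_n) p.2.+1%:R^-1 x /\
    ball (map_mx ratr p.1 : 'rV[R]_n) p.2.+1%:R^-1 `<=` U.
Proof.
move=> /nbhs_ballP[e /= e0 eU].
have e20 : 0 < e / 2 by rewrite divr_gt0.
have [k _ /(_ k (leqnn k)) /= ke] := near_infty_natSinv_lt (PosNum e20).
have k0 : 0 < k.+1%:R^-1 :> R by rewrite invr_gt0.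
have /choice[q qP] : forall i, exists q : rat,
    `|x 0 i - ratr q| < k.+1%:R^-1 :> R.
  move=> i; have [|q] := @rat_in_itvoo R (x 0 i - k.+1%:R^-1)
    (x 0 i + k.+1%:R^-1).
    by rewrite ltrD2l gtrN// invr_gt0.
  by rewrite in_itv/= => qI; exists q; rewrite distrC ltr_distl.
have xq : ball (map_mx ratr (\row_i q i) : 'rV[R]_n) k.+1%:R^-1 x.
  by split=> // i j; rewrite (ord1 i) !mxE /ball/= distrC; exact: qP.
exists (\row_i q i, k); split => //= v qv; apply: eU.
rewrite [e]splitr; apply: ball_triangle (le_ball (ltW ke) qv).
by apply/ball_sym; exact: (le_ball (ltW ke)) xq.
Qed.

End rational_balls.

Section product_support.
Variables (R : realType) (n : nat).
Local Notation E := 'rV[R]_n.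
Local Notation EE := (E * E)%type.

Let box (p : ('rV[rat]_n * nat) * ('rV[rat]_n * nat)) : set EE :=
  ball (map_mx ratr p.1.1 : E) p.1.2.+1%:R^-1 `*`
  ball (map_mx ratr p.2.1 : E) p.2.2.+1%:R^-1.

Let measurable_box p : measurable (box p).
Proof.
by apply: measurableX; apply: open_measurable_mx; apply: ball_open;
   rewrite invr_gt0.
Qed.

Let box_nbhs (z : EE) (U : set EE) : nbhs z U -> exists p, box p z /\ box p `<=` U.
Proof.
move=> [[/= V W]] [/= Vz Wz] VWU.
have [p [pz pV]] := rat_ball_nbhs Vz.
have [q [qz qW]] := rat_ball_nbhs Wz.
by exists (p, q); split=> // -[x y] [/= px qy]; apply: VWU; split; [exact: pV|exact: qW].
Qed.

Lemma open_measurable_prod_rV (U : set EE) : open U -> measurable U.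
Proof.
move=> oU.
have -> : U = \bigcup_p (if `[< box p `<=` U >] then box p else set0).
  apply/seteqP; split=> [z Uz|z [p _]]; last first.
    by case: ifPn => // /asboolP; exact.
  have [p [pz pU]] := box_nbhs (open_nbhs_nbhs (conj oU Uz)).
  by exists p => //; rewrite asboolT.
by apply: countable_bigcupT_measurable => // p; case: ifPn.
Qed.

Variable gamma : probability EE R.

Lemma supp_ae : {ae gamma, forall z, supp gamma z}.
Proof.
(* The complement of the support is covered by the null boxes. They are enumerated through
   [unpickle], with the empty set for a box of positive mass and for an integer that codes no
   box. *)
have : gamma.-negligible (\bigcup_k
    oapp (fun p => if gamma (box p) == 0%E then box p else set0) set0
      (unpickle k)).
  apply: negligible_bigcup => k; case: unpickle => [p|]/=; last first.
    exact: negligible_set0.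
  case: ifPn => [/eqP p0|_]; last exact: negligible_set0.
  by exists (box p); split => //; exact: measurable_box.
apply: negligibleS => z /=; apply: contra_notP => zb U oU Uz.
rewrite lt0e measure_ge0 andbT; apply/negP => /eqP U0; apply: zb.
have [p [pz pU]] := box_nbhs (open_nbhs_nbhs (conj oU Uz)).
exists (pickle p) => //; rewrite pickleK /= ifT//; apply/eqP.
apply: (subset_measure0 _ _ pU U0) => //.
exact: open_measurable_prod_rV.
Qed.

Lemma closed_supp : closed (supp gamma).
Proof.
rewrite -openC openE => z /= /existsNP[U] /not_implyP[oU] /not_implyP[Uz U0].
apply: (@filterS _ _ _ U); last exact: open_nbhs_nbhs.
by move=> z' Uz' /(_ U oU Uz').
Qed.

End product_support.

Section inverse_density.
Variables (R : realType) (d : nat).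
Local Notation E := 'rV[R]_d.
Variables (mu : {measure set E -> \bar R}) (rho : E -> R).
Hypothesis murho : is_density mu rho.
Local Open Scope ereal_scope.

Let ae (e g r : R) : (0 < e)%R -> (0 <= g)%R -> (0 <= r)%R ->
  g%:E <= e^-1%:E * ((g ^+ 2)%:E * r%:E) + e%:E * (r%:E)^-1.
Proof.
move=> e0 g0; rewrite le_eqVlt => /predU1P[<-|r0].
  (* At [r = 0] the right-hand side is [+oo], the inverse of 0 in [\bar R]. *)
  by rewrite inver eqxx gt0_muley ?lte_fin// !mule0 add0e leey.
rewrite inver gt_eqF// -!EFinM -EFinD lee_fin.
rewrite -subr_ge0.
have -> : (e^-1 * (g ^+ 2 * r) + e / r - g =
  (e * r)^-1 * ((g * r - e / 2) ^+ 2 + 3 / 4 * e ^+ 2))%R.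
  by field; rewrite !gt_eqF.
rewrite mulr_ge0 ?invr_ge0 ?(mulr_ge0 (ltW e0) (ltW r0))//.
by rewrite addr_ge0 ?sqr_ge0// mulr_ge0 ?sqr_ge0//; lra.
Qed.

(* AM-GM: [g <= g^2 rho / e + e / rho] *)
Lemma inverse_density_bound (K : set E) (g : E -> R) (e : R) :
  measurable K -> measurable_fun setT g -> (forall x, 0 <= g x)%R ->
  (0 < e)%R ->
  \int[leb R d]_(x in K) (g x)%:E <=
    e^-1%:E * \int[mu]_x (g x ^+ 2)%:E +
    e%:E * \int[leb R d]_(x in K) ((rho x)%:E)^-1.
Proof.
case: murho => mrho rho0 dens mK mg g0 e0.
have mg2 : measurable_fun setT (fun x => (g x ^+ 2)%:E).
  by apply/measurable_EFinP; exact: measurable_funX.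
have minv : measurable_fun setT (fun x => ((rho x)%:E)^-1).
  under eq_fun do rewrite inver.
  apply: measurable_fun_ifT => //.
    exact: measurable_fun_eqr.
  apply/measurable_EFinP.
  under eq_fun do rewrite -powR_inv1//.
  exact: measurableT_comp (measurable_powR _) mrho.
have mg2r : measurable_fun setT (fun x => (g x ^+ 2)%:E * (rho x)%:E).
  by apply: emeasurable_funM => //; exact/measurable_EFinP.
have ie0 : (0 <= e^-1)%R by rewrite invr_ge0 ltW.
rewrite (ge0_integral_density mrho rho0 dens)//; last first.
  by move=> x; rewrite lee_fin sqr_ge0.
apply: (@le_trans _ _ (\int[leb R d]_(x in K)
  (e^-1%:E * ((g x ^+ 2)%:E * (rho x)%:E) + e%:E * ((rho x)%:E)^-1))).
  apply: ge0_le_integral => //.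
  - by move=> x _; rewrite lee_fin.
  - by apply/measurable_EFinP; exact: measurable_funTS.
  - by apply: measurable_funTS; apply: emeasurable_funD; apply: emeasurable_funM.
  - by move=> x _; exact: ae.
rewrite ge0_integralD//; last 4 first.
- by move=> x _; rewrite !mule_ge0// lee_fin// sqr_ge0.
- by apply: measurable_funTS; apply: emeasurable_funM.
- by move=> x _; rewrite mule_ge0 ?inve_ge0// lee_fin// ltW.
- by apply: measurable_funTS; apply: emeasurable_funM.
rewrite [X in _ + X <= _]ge0_integralZl//; last 3 first.
- exact: measurable_funTS.
- by move=> x _; rewrite inve_ge0 lee_fin.
- by rewrite lee_fin ltW.
rewrite leeD2r// -ge0_integralZl//; last by move=> x _; rewrite mule_ge0// lee_fin// sqr_ge0.
apply: ge0_subset_integral => //.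
- by apply: emeasurable_funM.
- by move=> x _; rewrite !mule_ge0// lee_fin// sqr_ge0.
Qed.

End inverse_density.

Section balls.
Variables (R : realType) (d : nat).
Local Notation E := 'rV[R]_d.

(** Balls of the sup norm are cubes of side [2 * r]. *)
Lemma leb_ball (c : E) (r : R) : 0 < r ->
  leb R d (ball c r) = ((2 * r) ^+ d)%:E.
Proof.
move=> r0.
have -> : ball c r = [set v : E | forall i, ball (c 0 i) r (v 0 i)].
  apply/seteqP; split=> v /=; first by move=> [_ h] i; exact: h.
  by move=> h; split=> // i j; rewrite (ord1 i).
rewrite (@leb_box R d (fun i => ball (c 0 i) r)); last first.
  by move=> i; apply: open_measurable; exact: ball_open.
under eq_bigr do rewrite (lebesgue_measure_ball _ (ltW r0)).
by rewrite prodEFin prodr_const card_ord mulr_natl.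
Qed.

Lemma closed_measurable_rV (K : set E) : closed K -> measurable K.
Proof.
by move=> cK; rewrite -[K]setCK; apply: measurableC; apply: open_measurable_mx; rewrite openC.
Qed.

Lemma continuous_measurable_rV (f : E -> R) :
  continuous f -> measurable_fun [set: E] f.
Proof.
move=> cf; apply: (measurability _ (RGenOpens.measurableE R)).
move=> _ [_ [a [b ->]] <-]; rewrite setTI; apply: open_measurable_mx.
by apply: open_comp; last exact: interval_open.
Qed.

Definition cube (M : R) : set E := [set v | `|v| <= M].

Lemma cube_closed M : closed (cube M).
Proof.
by apply: (closed_comp _ (@closed_le _ M)) => x _; exact: norm_continuous.
Qed.

Lemma cube_compact M : compact (cube M).
Proof.
apply: bounded_closed_compact (@cube_closed M).
exists M; split; first exact: num_real.
by move=> N MN v /= /le_trans; apply; exact: ltW.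
Qed.

Lemma measurable_cube M : measurable (cube M).
Proof. by apply: closed_measurable_rV; exact: cube_closed. Qed.

End balls.

(** * The velocity field at time [s] *)

Section velocity.
Variables (R : realType) (d : nat).
Local Notation E := 'rV[R]_d.
Local Notation EE := (E * E)%type.
Variables (S : set EE) (s : R).
Hypotheses (s0 : 0 < s) (s1 : s < 1).
Hypothesis mono : forall p q, S p -> S q ->
  0 <= dot (p.1 - q.1) (p.2 - q.2).

(** A sup-norm Lipschitz constant for the inverse of [interpolate s] on [S]. The terms serve [p.2]
    and [p.1] respectively, and [1 + d] dominates the square root of [d] lost between the two
    norms. *)
Let L : R := (1 + d%:R) / s + (1 + d%:R) / (1 - s).

Let L_gt0 : 0 < L.
Proof. by rewrite addr_gt0// divr_gt0 ?subr_gt0// ltr_pwDl. Qed.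

Let lip_coord (c : R) (u w : E) : 0 < c -> c ^+ 2 * sqnorm u <= sqnorm w ->
  `|u| <= (1 + d%:R) / c * `|w|.
Proof.
move=> c0 uw; rewrite mulrAC ler_pdivlMr// -(@ler_pXn2r _ 2) ?nnegrE ?mulr_ge0//.
  rewrite !exprMn mulrC (@le_trans _ _ (d%:R * `|w| ^+ 2))//.
    apply: le_trans (sqnorm_le_norm w); apply: le_trans uw.
    by rewrite ler_wpM2l ?sqr_ge0// norm_sq_le_sqnorm.
  rewrite ler_wpM2r ?sqr_ge0//; have : 0 <= d%:R :> R by []; nra.
exact: ltW.
Qed.

Let lip_inverse p q : S p -> S q ->
  `|p.1 - q.1| <= L * `|interpolate s p - interpolate s q| /\
  `|p.2 - q.2| <= L * `|interpolate s p - interpolate s q|.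
Proof.
move=> Sp Sq; have [h1 h2 _ _] := monotone_velocity s0 s1 (mono Sp Sq).
have t0 : 0 < 1 - s by rewrite subr_gt0.
split; [apply: le_trans (lip_coord t0 h1) _|apply: le_trans (lip_coord s0 h2) _];
  by rewrite ler_wpM2r// /L ?lerDl ?lerDr ltW// divr_gt0// ltr_pwDl.
Qed.

(** Since the inverse of [interpolate s] on [S] is Lipschitz, points of [S] whose images tend to [z]
    form a Cauchy sequence; its limit lies in the closed set [S]. *)
Lemma interpolate_image_closed (z : E) : closed S ->
  (forall r, 0 < r -> exists2 p, S p & ball z r (interpolate s p)) ->
  exists2 p, S p & interpolate s p = z.
Proof.
move=> cS zS.
have /choice[u /all_and2[Su uz]] : forall n, exists p,
    S p /\ ball z n.+1%:R^-1 (interpolate s p).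
  by move=> n; have [|p] := zS n.+1%:R^-1; [rewrite invr_gt0|exists p].
have Icvg : interpolate s (u n) @[n --> \oo] --> z.
  apply/cvgrPdist_lt => e e0.
  near=> n; have := uz n; rewrite -ball_normE /= => /lt_trans; apply.
  by near: n; exact: (near_infty_natSinv_lt (PosNum e0)).
have ucvg (f : EE -> E) : (forall p q, S p -> S q ->
    `|f p - f q| <= L * `|interpolate s p - interpolate s q|) ->
    cvg (f (u n) @[n --> \oo]).
  move=> fL; apply: cauchy_cvg; apply: cauchy_exP => e e0.
  have e1 : 0 < e / (L * 2) by rewrite divr_gt0// mulr_gt0.
  have [N _ Ne] := near_infty_natSinv_lt (PosNum e1).
  exists (f (u N)); exists N => // n /= Nn.
  have IN : `|interpolate s (u N) - interpolate s (u n)| < e / L.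
    have -> : e / L = e / (L * 2) + e / (L * 2).
      by field; rewrite gt_eqF.
    have := uz N; have := uz n; rewrite -!ball_normE /= => hn hN.
    have -> : interpolate s (u N) - interpolate s (u n) =
      (z - interpolate s (u n)) - (z - interpolate s (u N)).
      move: (interpolate s (u N)) (interpolate s (u n)) => a b.
      by apply/rowP => i; rewrite !mxE; ring.
    rewrite (le_lt_trans (ler_normB _ _))// ltrD//.
      exact: lt_trans hn (Ne _ Nn).
    exact: lt_trans hN (Ne _ (leqnn N)).
  rewrite -ball_normE /= (le_lt_trans (fL _ _ (Su N) (Su n)))//.
  by rewrite mulrC -ltr_pdivlMr.
have [x ux] : exists x : E, (u n).1 @[n --> \oo] --> x.
  by apply/cvg_ex; apply: (ucvg fst) => p q Sp Sq; have [] := lip_inverse Sp Sq.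
have [y uy] : exists y : E, (u n).2 @[n --> \oo] --> y.
  by apply/cvg_ex; apply: (ucvg snd) => p q Sp Sq; have [] := lip_inverse Sp Sq.
exists (x, y).
  have uxy : ((u n).1, (u n).2) @[n --> \oo] --> (x, y).
    exact: (cvg_pair ux uy).
  apply: (closed_cvg S cS _ _ uxy); apply/nearW => n.
  by rewrite -surjective_pairing.
apply: (@cvg_unique _ (@norm_hausdorff _ _) (interpolate s (u n) @[n --> \oo])) => //.
by apply: cvgD; apply: cvgZr.
Unshelve. all: by end_near. Qed.

(** The preimage [P z] of [z] in [S] is unique by the Lipschitz bound on the inverse, so the chosen
    velocity agrees with [p.2 - p.1] at every [p] of [S]. *)
Lemma velocity_exists :
  (forall z, exists2 p, S p & interpolate s p = z) ->
  exists v : E -> E, [/\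
    forall p, S p -> v (interpolate s p) = p.2 - p.1,
    exists2 M, 0 < M & forall z z', `|v z - v z'| <= M * `|z - z'|,
    forall z z', s * dot (v z - v z') (z - z') <= sqnorm (z - z') &
    forall z z', - ((1 - s) * dot (v z - v z') (z - z')) <= sqnorm (z - z')].
Proof.
move=> surj; have /choice[P /all_and2[SP IP]] : forall z, exists p,
    S p /\ interpolate s p = z by move=> z; have [p] := surj z; exists p.
exists (fun z => (P z).2 - (P z).1); split.
- move=> p Sp; have [] := lip_inverse (SP (interpolate s p)) Sp.
  by rewrite IP subrr normr0 mulr0 !normr_le0 !subr_eq0 => /eqP-> /eqP->.
- exists (L * 2); first by rewrite mulr_gt0.
  move=> z z'; have [h1 h2] := lip_inverse (SP z) (SP z'); rewrite !IP in h1 h2.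
  have -> : (P z).2 - (P z).1 - ((P z').2 - (P z').1) =
     ((P z).2 - (P z').2) - ((P z).1 - (P z').1).
    by apply/rowP => i; rewrite !mxE; ring.
  by rewrite (le_trans (ler_normB _ _))// -mulrA mulrCA mulr_natl mulr2n lerD.
- move=> z z'; have [_ _ + _] := monotone_velocity s0 s1 (mono (SP z) (SP z')).
  by rewrite !IP.
- move=> z z'; have [_ _ _] := monotone_velocity s0 s1 (mono (SP z) (SP z')).
  by rewrite !IP.
Qed.

End velocity.

(** * Closed polygonal Riemann sums *)

Section taylor.
Variables (R : realType) (d : nat).
Local Notation E := 'rV[R]_d.
Variable phi : E -> R.
Local Notation e_ i := (delta_mx 0 i : E).
Hypothesis dphi : forall x i, derivable phi x (e_ i).

Let line_derive (x : E) i (t : R) :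
  is_derive t 1 (fun t => phi (x + t *: e_ i)) (gradient phi (x + t *: e_ i) 0 i).
Proof.
have eqf : (fun h : R => h^-1 *: ((fun t => phi (x + t *: e_ i)) (h *: 1 + t) -
      (fun t => phi (x + t *: e_ i)) t)) =
    (fun h : R => h^-1 *: (phi (h *: e_ i + (x + t *: e_ i)) - phi (x + t *: e_ i))).
  apply/funext => h /=; congr (_ *: (phi _ - _)).
  by rewrite [h *: 1]mulr1 scalerDl addrCA.
apply: DeriveDef; rewrite /derivable/= ?/derive ?mxE /derive /= eqf//.
exact: dphi.
Qed.

Let mean_value (x : E) i (l : R) : exists2 t, `|t| <= `|l| &
  phi (x + l *: e_ i) - phi x = gradient phi (x + t *: e_ i) 0 i * l.
Proof.
pose f t := phi (x + t *: e_ i).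
have df t := line_derive x i t.
have cf a b : {within `[a, b], continuous f}.
  apply: continuous_subspaceT => t; apply: differentiable_continuous.
  by apply/derivable1_diffP; case: (df t).
have f0 : f 0 = phi x by rewrite /f scale0r addr0.
have [l0|l0] := leP 0 l.
  have [t] := MVT_segment l0 (fun t _ => df t) (cf 0 l).
  rewrite in_itv /= => /andP[t0 tl] h; exists t; first by rewrite !ger0_norm.
  by rewrite -f0 -/(f l) h subr0.
have [t] := MVT_segment (ltW l0) (fun t _ => df t) (cf l 0).
rewrite in_itv /= => /andP[tl t0] h; exists t.
  by rewrite !ler0_norm ?lerN2// ltW.
by rewrite -f0 -/(f l) -opprB -/(f 0) h sub0r mulrN opprK.
Qed.

Hypothesis cphi : forall i, continuous (fun x => gradient phi x 0 i).

(** Heine's theorem, in a form where only the base point [a] has to lie in [K]: compactness is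
    applied to a property of the pair of [a] and the increment near 0. *)
Lemma gradient_uniform_continuous (K : set E) (delta : R) : compact K ->
  0 < delta ->
  exists2 eta, 0 < eta & forall a h, K a -> `|h| < eta ->
    forall i, `|gradient phi (a + h) 0 i - gradient phi a 0 i| <= delta.
Proof.
move=> /compact_near_coveringP cK delta0.
pose P (h a : E) :=
  forall i, `|gradient phi (a + h) 0 i - gradient phi a 0 i| <= delta.
have : \forall h \near (0 : E), K `<=` P h.
  apply: (cK E (nbhs (0 : E)) P) => a Ka.
  suff : \forall p \near (a, 0 : E), forall i,
      `|gradient phi (p.1 + p.2) 0 i - gradient phi p.1 0 i| <= delta by [].
  apply: (@filter_forall _ _ (fun i (p : E * E) =>
    `|gradient phi (p.1 + p.2) 0 i - gradient phi p.1 0 i| <= delta)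
    (nbhs (a, 0 : E))) => i.
  have ca := @cphi i a.
  have cah : gradient phi (p.1 + p.2) 0 i @[p --> (a, 0 : E)] -->
      gradient phi a 0 i.
    apply: (@cvg_comp _ _ _ (fun p : E * E => p.1 + p.2)
      (fun x => gradient phi x 0 i) _ (nbhs a)) => //.
    have := @add_continuous E (a, 0 : E).
    by rewrite /continuous_at /= addr0.
  have ca1 : gradient phi p.1 0 i @[p --> (a, 0 : E)] --> gradient phi a 0 i.
    by apply: (@cvg_comp _ _ _ fst (fun x => gradient phi x 0 i) _ (nbhs a)) => //; exact: cvg_fst.
  have /cvgrPdist_le/(_ _ delta0) :
      gradient phi (p.1 + p.2) 0 i - gradient phi p.1 0 i
        @[p --> (a, 0 : E)] --> gradient phi a 0 i - gradient phi a 0 i.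
    exact: cvgB.
  by apply: filterS => p /=; rewrite subrr sub0r normrN.
move=> /nbhs_ballP[eta /= eta0 h]; exists eta => // a u Ka ue.
by apply: h => //; rewrite -ball_normE /= sub0r normrN.
Qed.

Lemma uniform_taylor (K : set E) (delta : R) : compact K -> 0 < delta ->
  exists2 eta, 0 < eta & forall a b, K a -> `|b - a| < eta ->
    `|phi b - phi a - dot (gradient phi a) (b - a)| <= delta * `|b - a|.
Proof.
move=> cK delta0.
have D0 : 0 < 1 + d%:R :> R by rewrite ltr_pwDl.
have [eta eta0 H] := gradient_uniform_continuous cK (divr_gt0 delta0 D0).
exists eta => // a b Ka bae.
(* Only partial derivatives are at hand: [b] is reached from [a] by changing one coordinate at a
   time, with the mean value theorem on each edge. *)
pose c (k : nat) : E := \row_i (if (i < k)%N then b 0 i else a 0 i).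
have c0 : c 0%N = a by apply/rowP => i; rewrite mxE.
have cd : c d = b by apply/rowP => i; rewrite mxE ltn_ord.
have cS (i : 'I_d) : c i.+1 = c i + (b - a) 0 i *: e_ i.
  apply/rowP => j; rewrite !mxE eqxx /= ltnS.
  case: (ltngtP j i) => [ji|ij|/val_inj->].
  - by rewrite (_ : j == i = false) ?mulr0 ?addr0// lt_eqF.
  - by rewrite (_ : j == i = false) ?mulr0 ?addr0// gt_eqF.
  - by rewrite eqxx mulr1 addrC subrK.
have -> : phi b - phi a = \sum_(i < d) (phi (c i.+1) - phi (c i)).
  rewrite -(big_mkord xpredT (fun i => phi (c i.+1) - phi (c i))).
  by rewrite (telescope_sumr (phi \o c))//= c0 cd.
rewrite -sumrB (le_trans (ler_norm_sum _ _ _))//.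
apply: (@le_trans _ _ (\sum_(i < d) delta / (1 + d%:R) * `|b - a|)); last first.
  rewrite sumr_const card_ord -mulrnAl ler_wpM2r// -mulr_natr -mulrA.
  by rewrite ger_pMr// mulrC ler_pdivrMr// mul1r lerDr.
apply: ler_sum => i _.
have [t tl ->] : exists2 t, `|t| <= `|(b - a) 0 i| & phi (c i.+1) - phi (c i) =
    gradient phi (c i + t *: e_ i) 0 i * (b - a) 0 i.
  by rewrite cS; exact: mean_value.
rewrite -mulrBl normrM ler_pM ?coord_le_norm//.
have -> : c i + t *: e_ i = a + (c i + t *: e_ i - a).
  by rewrite [RHS]addrC subrK.
apply: H => //; apply: le_lt_trans bae; apply: norm_le_coord => // j.
rewrite !mxE eqxx /=; case: (ltngtP j i) => [ji|ij|/val_inj->].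
- rewrite (_ : j == i = false) ?mulr0 ?addr0 ?lt_eqF//.
  by have := coord_le_norm (b - a) j; rewrite !mxE.
- by rewrite (_ : j == i = false) ?mulr0 ?addr0 ?subrr ?normr0 ?gt_eqF.
- by rewrite eqxx mulr1 addrAC subrr add0r (le_trans tl)// coord_le_norm.
Qed.

End taylor.

(** * Averages over translates *)

Section averaging.
Variables (R : realType) (d : nat).
Local Notation E := 'rV[R]_d.
Local Open Scope ereal_scope.

(** Integrate the lower bound [c] over the ball of radius [r]: each translate of that ball by a
    point of [qs] stays in the cube, so each summand contributes at most [eta]. *)
Lemma averaging_bound (g : E -> R) (qs : seq E) (Q r c eta : R) :
  measurable_fun setT g -> (forall x, 0 <= g x)%R -> (0 < r)%R ->
  (forall q, q \in qs -> `|q| + r <= Q)%R ->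
  (forall a, `|a| < r -> c <= \sum_(q <- qs) g (a + q))%R ->
  \int[leb R d]_(x in cube Q) (g x)%:E <= eta%:E ->
  (c * (2 * r) ^+ d <= (size qs)%:R * eta)%R.
Proof.
move=> mg g0 r0 qsQ cle int_le.
have eta0 : (0 <= eta)%R.
  by rewrite -lee_fin (le_trans _ int_le)// integral_ge0// => x _; rewrite lee_fin.
have [c0|c0] := leP 0%R c; last first.
  rewrite (@le_trans _ _ 0%R) ?mulr_ge0// ltW// pmulr_llt0//.
  by rewrite exprn_gt0// mulr_gt0.
pose B : set E := ball (0 : E)%R r.
have mB : measurable B by apply: open_measurable_mx; exact: ball_open.
have mgq q : measurable_fun setT (fun a : E => (g (a + q))%:E).
  by apply/measurable_EFinP; exact: measurableT_comp mg (measurable_translation q).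
rewrite -lee_fin EFinM -(leb_ball (0 : E)%R r0) -/B -integral_cst//.
apply: (@le_trans _ _ (\int[leb R d]_(a in B) \sum_(q <- qs) (g (a + q))%:E)).
  apply: ge0_le_integral => //.
  - by apply: emeasurable_sum => q _; exact: measurable_funTS.
  - move=> a; rewrite /B -ball_normE /= sub0r normrN => ar.
    by rewrite sumEFin lee_fin cle.
rewrite ge0_integral_sum//; last 2 first.
- by move=> q; exact: measurable_funTS.
- by move=> q x _; rewrite lee_fin.
rewrite big_seq (@le_trans _ _ (\sum_(q <- qs | q \in qs) eta%:E))//; last first.
  by rewrite -big_seq sumEFin lee_fin big_const_seq count_predT iter_addr_0 mulr_natl.
apply: lee_sum => q qqs; apply: le_trans int_le.
rewrite -(@ge0_integral_leb_translation _ _ q (cube Q))//; last 2 first.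
- exact: measurable_cube.
- by apply/measurable_EFinP; exact: measurable_funTS.
apply: ge0_subset_integral => //.
- rewrite -[X in measurable X]setTI.
  by apply: measurable_translation => //; exact: measurable_cube.
- exact: measurable_funTS.
- by move=> x _; rewrite lee_fin.
move=> a; rewrite /B -ball_normE /= sub0r normrN /cube /= => ar.
by rewrite (le_trans (ler_normD _ _))// addrC (le_trans _ (qsQ _ qqs))// lerD2l ltW.
Qed.

End averaging.

Lemma lipschitz_continuous (R : realType) d (f : 'rV[R]_d -> 'rV[R]_d) (M : R) :
  0 < M -> (forall z z', `|f z - f z'| <= M * `|z - z'|) -> continuous f.
Proof.
move=> M0 fM x; apply/(@cvgrPdist_lt _ _ _ (nbhs x) (nbhs_filter x)) => e e0.
apply/nbhs_ballP.
exists (e / M); rewrite /= ?divr_gt0// => y; rewrite -ball_normE /= => xy.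
by rewrite (le_lt_trans (fM _ _))// mulrC -ltr_pdivlMr.
Qed.

Section riemann.
Variables (R : realType) (d : nat).
Local Notation E := 'rV[R]_d.

Definition node (z z' : E) (m k : nat) : E := z + (k%:R / m.+1%:R) *: (z' - z).

Lemma node0 z z' m : node z z' m 0 = z.
Proof. by rewrite /node mul0r scale0r addr0. Qed.

Lemma node_last z z' m : node z z' m m.+1 = z'.
Proof. by rewrite /node divff// scale1r addrC subrK. Qed.

Lemma nodeS z z' m k :
  node z z' m k.+1 - node z z' m k = m.+1%:R^-1 *: (z' - z).
Proof.
rewrite /node opprD addrACA subrr add0r -scalerBl -mulrBl.
by rewrite -natr1 [_ + 1]addrC addrK mul1r.
Qed.

Lemma node_translation a z z' m k : node (a + z) (a + z') m k = a + node z z' m k.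
Proof. by rewrite /node opprD addrACA subrr add0r addrA. Qed.

Lemma node_le z z' m k Q : (k <= m)%N -> `|z| <= Q -> `|z'| <= Q ->
  `|node z z' m k| <= Q.
Proof.
move=> km zQ z'Q.
set t : R := k%:R / m.+1%:R.
have t0 : 0 <= t by rewrite divr_ge0.
have t1 : t <= 1 by rewrite ler_pdivrMr// mul1r ler_nat ltnW.
have -> : node z z' m k = (1 - t) *: z + t *: z'.
  by rewrite /node -/t scalerBl scale1r scalerBr addrA addrAC.
clearbody t; rewrite (le_trans (ler_normD _ _))// !normrZ.
rewrite (ger0_norm t0) ger0_norm ?subr_ge0//.
have := ler_wpM2l t0 z'Q; have : 0 <= 1 - t by rewrite subr_ge0.
move=> /ler_wpM2l/(_ _ _ zQ); lra.
Qed.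

Variables (v : E -> E) (M : R).
Hypotheses (M0 : 0 < M) (vM : forall z z', `|v z - v z'| <= M * `|z - z'|).

(** Left Riemann sum, with [m + 1] equal steps, for the circulation of [v] along the segment from
    [z] to [z']. *)
Definition riemann_sum (z z' : E) (m : nat) : R :=
  m.+1%:R^-1 * \sum_(0 <= k < m.+1) dot (v (node z z' m k)) (z' - z).

(** All nodes move by [a], so the bound is uniform in [m]; this allows the averaging radius to be
    fixed before the mesh. *)
Lemma riemann_sum_translation a z z' m D : `|z' - z| <= D ->
  `|riemann_sum (a + z) (a + z') m - riemann_sum z z' m| <=
    d%:R * (M * `|a| * D).
Proof.
move=> zD.
rewrite /riemann_sum -mulrBr -sumrB normrM ger0_norm ?invr_ge0//.
rewrite mulrC ler_pdivrMr// (le_trans (ler_norm_sum _ _ _))//.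
rewrite -[X in _ * X%:R]subn0 -sumr_const_nat mulr_sumr ler_sum// => k _.
rewrite mulr1 node_translation opprD addrACA subrr add0r -dotNl -dotDl.
rewrite (le_trans (dot_le_norm _ _))// ler_wpM2l// ler_pM//.
by rewrite (le_trans (vM _ _))// addrK.
Qed.

Variable tau : R.
(** Motion along straight lines during a time [tau], which will be [t - s]. *)
Let X z := z + tau *: v z.
Let L := 1 + `|tau| * M.

Let X_lip z z' : `|X z - X z'| <= L * `|z - z'|.
Proof.
rewrite /X opprD addrACA -scalerBr (le_trans (ler_normD _ _))//.
by rewrite mulrDl mul1r lerD2l normrZ -mulrA ler_wpM2l.
Qed.

Let L_gt0 : 0 < L.
Proof. by rewrite ltr_pwDl// mulr_ge0// ltW. Qed.

(* Along the nodes [z_k], with [dX_k = dz_k + tau dv_k],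
   [<v_k, dX_k> = <v_k, dz_k> + tau / 2 (d|v_k|^2 - |dv_k|^2)]:
   the increments of [|v|^2] telescope and the last term is [O(1 / m^2)]. *)
Let riemann_side (phi : E -> R) (K : set E) (delta eta D : R) z z' m :
  0 <= delta ->
  (forall a b, K a -> `|b - a| < eta ->
    `|phi b - phi a - dot (gradient phi a) (b - a)| <= delta * `|b - a|) ->
  (forall k, (k <= m)%N -> K (X (node z z' m k))) ->
  `|z' - z| <= D -> L * D / m.+1%:R < eta ->
  `|phi (X z') - phi (X z) -
     (riemann_sum z z' m + tau / 2 * (sqnorm (v z') - sqnorm (v z)))| <=
  d%:R * L * D / m.+1%:R *
    (\sum_(0 <= k < m.+1) `|gradient phi (X (node z z' m k)) - v (node z z' m k)|)
  + delta * (L * D) + `|tau| * d%:R * (M * D) ^+ 2 / m.+1%:R.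
Proof.
move=> delta0 taylor KX zD small.
have D0 : 0 <= D by apply: le_trans zD.
have i0 : 0 < m.+1%:R^-1 :> R by rewrite invr_gt0.
pose n k := node z z' m k.
pose f k := phi (X (n k)) - tau / 2 * sqnorm (v (n k)).
have fE : f m.+1 - f 0%N =
    phi (X z') - phi (X z) - tau / 2 * (sqnorm (v z') - sqnorm (v z)).
  by rewrite /f /n node0 node_last; ring.
have -> : phi (X z') - phi (X z) -
     (riemann_sum z z' m + tau / 2 * (sqnorm (v z') - sqnorm (v z))) =
     \sum_(0 <= k < m.+1)
       (f k.+1 - f k - m.+1%:R^-1 * dot (v (n k)) (z' - z)).
  by rewrite sumrB telescope_sumr// fE /riemann_sum -mulr_sumr; ring.
rewrite (le_trans (ler_norm_sum _ _ _))//.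
apply: (@le_trans _ _ (\sum_(0 <= k < m.+1)
  (d%:R * L * D / m.+1%:R * `|gradient phi (X (n k)) - v (n k)| +
   (delta * (L * D) / m.+1%:R + `|tau| * d%:R * (M * D) ^+ 2 / m.+1%:R ^+ 2))));
  last first.
  rewrite big_split /= -mulr_sumr sumr_const_nat subn0 -addrA lerD2l.
  rewrite -[leLHS]mulr_natr le_eqVlt; apply/orP; left; apply/eqP.
  by field; rewrite gt_eqF.
apply: ler_sum_nat => k /andP[_ km].
have dz : n k.+1 - n k = m.+1%:R^-1 *: (z' - z) by exact: nodeS.
have dzD : `|n k.+1 - n k| <= D / m.+1%:R.
  by rewrite dz normrZ ger0_norm ?(ltW i0)// mulrC ler_wpM2r// ltW.
have dXD : `|X (n k.+1) - X (n k)| <= L * D / m.+1%:R.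
  by rewrite (le_trans (X_lip _ _))// -mulrA ler_wpM2l// ltW.
have dvD : `|v (n k.+1) - v (n k)| <= M * D / m.+1%:R.
  by rewrite (le_trans (vM _ _))// -mulrA ler_wpM2l// ltW.
have T := taylor _ _ (KX k km) (le_lt_trans dXD small).
set w := gradient phi _ in T *.
(* Three errors per step: the gradient error paired with [dX_k], the Taylor remainder of [phi], and
   the quadratic term in [dv_k]. *)
have -> : f k.+1 - f k - m.+1%:R^-1 * dot (v (n k)) (z' - z) =
  dot (w - v (n k)) (X (n k.+1) - X (n k)) +
  ((phi (X (n k.+1)) - phi (X (n k)) - dot w (X (n k.+1) - X (n k))) -
   tau / 2 * sqnorm (v (n k.+1) - v (n k))).
  rewrite /f -(dotZr m.+1%:R^-1) -dz /X !sqnormE !dotE (dotC (v (n k)) (v (n k.+1))).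
  by field.
rewrite (le_trans (ler_normD _ _))// lerD//.
  rewrite (le_trans (dot_le_norm _ _))//.
  rewrite [leRHS](_ : _ = d%:R * (`|w - v (n k)| * (L * D / m.+1%:R))); last by ring.
  by rewrite ler_wpM2l// ler_wpM2l.
rewrite (le_trans (ler_normB _ _))// lerD//.
  by rewrite (le_trans T)// -mulrA ler_wpM2l.
rewrite normrM (ger0_norm (sqnorm_ge0 _)).
rewrite normrM (@ger0_norm _ 2^-1)// -!mulrA.
rewrite ler_wpM2l//.
have := sqnorm_le_norm (v (n k.+1) - v (n k)).
have /(ler_wpM2l (ler0n R d)) : `|v (n k.+1) - v (n k)| ^+ 2 <= (M * D / m.+1%:R) ^+ 2.
  by rewrite lerXn2r ?nnegrE// mulr_ge0// ?(ltW i0)// mulr_ge0// ltW.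
rewrite expr_div_n.
rewrite [X in _ -> _ -> _ <= X](_ : _ = d%:R * ((M * D) ^+ 2 / m.+1%:R ^+ 2)).
  have := sqnorm_ge0 (v (n k.+1) - v (n k)).
  by move: (sqnorm _) (_ * (_ / _)) => a b; lra.
by ring.
Qed.

Let v_continuous : continuous v.
Proof. exact: lipschitz_continuous M0 vM. Qed.

Let X_continuous : continuous X.
Proof. exact: lipschitz_continuous L_gt0 X_lip. Qed.

Lemma measurable_gradient_error (phi : E -> R) :
  (forall i, continuous (fun x => gradient phi x 0 i)) ->
  measurable_fun [set: E] (fun x => `|gradient phi (X x) - v x|).
Proof.
move=> cphi.
apply: (@measurableT_comp _ _ _ _ _ _ (fun x : E => `|x|)).
  by apply: continuous_measurable_rV; exact: norm_continuous.
apply: measurable_fun_rV => i.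
rewrite [X in measurable_fun _ X](_ : _ =
    (fun x => gradient phi (X x) 0 i - v x 0 i)); last first.
  by apply/funext => x; rewrite !mxE.
apply: continuous_measurable_rV => x.
have c1 : {for x, continuous (fun x => gradient phi (X x) 0 i)}.
  apply: (@continuous_comp _ _ _ X (fun x => gradient phi x 0 i)).
    exact: X_continuous.
  exact: cphi.
have c2 : {for x, continuous (fun x => v x 0 i)}.
  apply: (@continuous_comp _ _ _ v (fun x : E => x 0 i)).
    exact: v_continuous.
  exact: coord_continuous.
exact: continuousB c1 c2.
Qed.

Hypothesis approx : forall Q eta, 0 < eta -> exists phi : E -> R, [/\
  forall x i, derivable phi x (delta_mx 0 i),
  forall i, continuous (fun x => gradient phi x 0 i) &
  (\int[leb R d]_(x in cube Q) (`|gradient phi (X x) - v x|)%:E <= eta%:E)%E].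

(* The error term is only small in [L^1], whence the average over the translates
   of the triangle [0, z, z'] by vectors of norm less than [r]; the sums depend
   on the translation in a Lipschitz way, uniformly in [m]. *)
Lemma riemann_triangle z z' eps : 0 < eps -> exists N, forall m, (N <= m)%N ->
  `|riemann_sum 0 z' m - riemann_sum 0 z m - riemann_sum z z' m| <= eps.
Proof.
move=> eps0.
pose D := `|z| + `|z'|.
have D0 : 0 <= D by rewrite addr_ge0.
have zD : `|z| <= D by rewrite lerDl.
have z'D : `|z'| <= D by rewrite lerDr.
have zz'D : `|z' - z| <= D by rewrite (le_trans (ler_normB _ _))// addrC.
(* One quarter of [eps] is allotted to each error: translation (through [r]), Taylor remainder
   ([delta]), gradient error ([eta]) and quadratic terms (large [m]). The added 1 in the constants
   keeps denominators positive. *)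
have e4 : 0 < eps / 4 by rewrite divr_gt0.
pose A := d%:R * (M * D) * 3.
have A0 : 0 <= A by rewrite !mulr_ge0// ltW.
pose r := eps / 4 / (A + 1).
have r0 : 0 < r by rewrite divr_gt0// ltr_wpDl.
have Ar : A * r <= eps / 4.
  by rewrite /r mulrCA ger_pMr// ler_pdivrMr ?ltr_wpDl// mul1r lerDl.
pose Q := D + r.
have LD0 : 0 <= 3 * (L * D) by rewrite !mulr_ge0// ltW.
pose delta := eps / 4 / (3 * (L * D) + 1).
have delta0 : 0 < delta by rewrite divr_gt0// ltr_wpDl.
have deltaLD : delta * (3 * (L * D)) <= eps / 4.
  by rewrite -mulrA ger_pMr// mulrC ler_pdivrMr ?ltr_wpDl// mul1r lerDl.
pose W := d%:R * L * D + 1.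
have W0 : 0 < W by rewrite ltr_wpDl// !mulr_ge0// ltW.
have rd0 : 0 < (2 * r) ^+ d by rewrite exprn_gt0// mulr_gt0.
pose eta := eps / 4 * (2 * r) ^+ d / (3 * W).
have eta0 : 0 < eta by rewrite divr_gt0 ?mulr_gt0.
have [phi [dphi cphi intphi]] := @approx Q eta eta0.
(* [X] maps [cube Q] into [cube Q'], where the Taylor estimate is taken. Its threshold [eta']
   depends on [phi], so the mesh is chosen last. *)
pose Q' := Q + `|tau| * (`|v 0| + M * Q).
have XQ x : `|x| <= Q -> `|X x| <= Q'.
  move=> xQ; rewrite (le_trans (ler_normD _ _))// lerD// normrZ ler_wpM2l//.
  have -> : v x = v 0 + (v x - v 0) by rewrite addrC subrK.
  rewrite (le_trans (ler_normD _ _))// lerD2l (le_trans (vM _ _))// subr0.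
  by rewrite ler_wpM2l// ltW.
have [eta' eta'0 taylor] := uniform_taylor dphi cphi (@cube_compact R d Q') delta0.
pose B := 3 * (`|tau| * d%:R * (M * D) ^+ 2).
have B0 : 0 <= B by rewrite mulr_ge0// mulr_ge0 ?sqr_ge0// mulr_ge0.
(* The first summand brings consecutive images under [X] within [eta'], the second makes
   [B / (m + 1)] at most [eps / 4]. *)
exists (Num.truncn (L * D / eta' + B / (eps / 4))) => m Nm.
have mN : L * D / eta' + B / (eps / 4) < m.+1%:R.
  by apply: lt_le_trans (truncnS_gt _) _; rewrite ler_nat.
have i0 : 0 < m.+1%:R^-1 :> R by rewrite invr_gt0.
have small : L * D / m.+1%:R < eta'.
  rewrite ltr_pdivrMr// [ltRHS]mulrC -ltr_pdivrMr//; apply: le_lt_trans mN.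
  by rewrite lerDl divr_ge0// ltW.
have Bm : B / m.+1%:R <= eps / 4.
  rewrite ler_pdivrMr// [leRHS]mulrC -ler_pdivrMr//; apply: le_trans (ltW mN).
  by rewrite lerDr divr_ge0// ?mulr_ge0// ltW.
pose T a := riemann_sum (a + 0) (a + z') m - riemann_sum (a + 0) (a + z) m -
  riemann_sum (a + z) (a + z') m.
pose g x := `|gradient phi (X x) - v x|.
pose qs := [seq node 0 z' m k | k <- index_iota 0 m.+1] ++
  [seq node 0 z m k | k <- index_iota 0 m.+1] ++
  [seq node z z' m k | k <- index_iota 0 m.+1].
pose F z z' := phi (X z') - phi (X z) -
     (riemann_sum z z' m + tau / 2 * (sqnorm (v z') - sqnorm (v z))).
have side a u u' : `|a| < r -> `|u| <= D -> `|u'| <= D -> `|u' - u| <= D ->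
    `|F (a + u) (a + u')| <= W / m.+1%:R *
    (\sum_(k <- index_iota 0 m.+1) g (a + node u u' m k)) +
    (delta * (L * D) + `|tau| * d%:R * (M * D) ^+ 2 / m.+1%:R).
  move=> ar uD u'D uu'D.
  have bnd w : `|w| <= D -> `|a + w| <= Q.
    by move=> wD; rewrite (le_trans (ler_normD _ _))// addrC lerD// ltW.
  apply: (le_trans (riemann_side (K := cube Q') (D := D) (ltW delta0) taylor _ _ small)).
  - by move=> k km; apply: XQ; apply: node_le => //; exact: bnd.
  - by rewrite opprD addrACA subrr add0r.
  rewrite -addrA lerD2r.
  under eq_bigr do rewrite node_translation.
  rewrite ler_wpM2r ?sumr_ge0// ler_wpM2r ?(ltW i0)//.
  by rewrite /W lerDl.
have Ta a : `|a| < r -> `|T a| <= W / m.+1%:R * (\sum_(q <- qs) g (a + q)) +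
    (delta * (3 * (L * D)) + B / m.+1%:R).
  move=> ar.
  (* Around the closed triangle the increments of [phi] and of the squared norm of [v] cancel,
     leaving the Riemann sums alone. *)
  have -> : T a = F (a + 0) (a + z) + F (a + z) (a + z') - F (a + 0) (a + z').
    by rewrite /T /F; ring.
  have n0 : `|0 : E| <= D by rewrite normr0.
  have := side a 0 z' ar n0 z'D; rewrite subr0 => /(_ z'D).
  have := side a 0 z ar n0 zD; rewrite subr0 => /(_ zD).
  have := side a z z' ar zD z'D zz'D.
  rewrite /qs 2!big_cat !big_map.
  move: (\sum_(_ <- _) _) (\sum_(_ <- _) _) (\sum_(_ <- _) _) => s1 s2 s3.
  rewrite /B -(mulrA 3 _ m.+1%:R^-1) (mulrCA delta 3) /=.
  move: (F _ _) (F _ _) (F _ _) => f1 f2 f3.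
  move: (W / _) (delta * _) (_ / m.+1%:R) => w1 w2 w3 h1 h2 h3.
  have := ler_normB (f2 + f3) f1; have := ler_normD f2 f3.
  move: (`|f1|) (`|f2|) (`|f3|) h1 h2 h3 => ? ? ?; lra.
have T0a a : `|a| < r -> `|T 0 - T a| <= A * r.
  move=> ar; rewrite /T !add0r.
  have h u u' : `|u' - u| <= D ->
      `|riemann_sum (a + u) (a + u') m - riemann_sum u u' m| <= d%:R * (M * D) * r.
    move=> uD; apply: (le_trans (riemann_sum_translation a m uD)).
    by rewrite -[leRHS]mulrA ler_wpM2l// mulrAC ler_wpM2l ?mulr_ge0 ?(ltW M0)// ltW.
  have := h 0 z'; rewrite subr0 => /(_ z'D).
  have := h 0 z; rewrite subr0 => /(_ zD).
  have := h z z' zz'D.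
  move: (riemann_sum 0 z' m) (riemann_sum 0 z m) (riemann_sum z z' m) => a1 a2 a3.
  move: (riemann_sum _ _ _) (riemann_sum _ _ _) (riemann_sum _ _ _) => b1 b2 b3.
  rewrite /A !ler_norml => /andP[? ?] /andP[? ?] /andP[? ?]; apply/andP; split; lra.
(* The part of [T 0] that only the gradient error can account for, whatever the translation [a] in
   the ball; averaging then makes it small. *)
pose c := `|T 0| - A * r - (delta * (3 * (L * D)) + B / m.+1%:R).
have cW : c * (m.+1%:R / W) * (2 * r) ^+ d <= (size qs)%:R * eta.
  apply: (averaging_bound (g := g) (Q := Q) (r := r)) => //.
  - exact: measurable_gradient_error.
  - by move=> x; exact: normr_ge0.
  - move=> q qqs; apply: lerD => //; move: qqs.
    rewrite /qs !mem_cat => /or3P[] /mapP[k];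
      rewrite mem_index_iota => /andP[_ km] ->; apply: node_le => //;
      by rewrite normr0.
  move=> a ar; rewrite -ler_pdivlMr ?divr_gt0// invf_div mulrC /c.
  have := Ta _ ar; have := T0a _ ar.
  have := ler_normD (T 0 - T a) (T a); rewrite subrK.
  by move: (W / _ * _) (B / _) (delta * _) (A * r) => *; lra.
have sz : size qs = (3 * m.+1)%N.
  by rewrite /qs !size_cat !size_map size_iota subn0 !mulSn mul0n addn0.
have ce : c <= eps / 4.
  move: cW; rewrite sz natrM -ler_pdivlMr// -ler_pdivlMr ?divr_gt0//.
  move=> /le_trans; apply; rewrite le_eqVlt; apply/orP; left; apply/eqP.
  by rewrite /eta; move: ((2 * r) ^+ d) rd0 => p p0; field; rewrite !gt_eqF.
have -> : riemann_sum 0 z' m - riemann_sum 0 z m - riemann_sum z z' m = T 0.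
  by rewrite /T !add0r.
move: Ar deltaLD Bm ce; rewrite /c.
by clear; move: (B / _) (delta * _) (A * r) `|T 0| => *; lra.
Qed.

End riemann.

(** * The potential of the velocity field *)

Section upper_limit.
Variable R : realType.

(** [G i] is the upper limit of [a i], the infimum of its eventual upper bounds; asymptotic
    inequalities between the sequences pass to it. *)
Lemma upper_limit_exists (I : Type) (a : I -> nat -> R) :
  (forall i, exists C, forall m, `|a i m| <= C) ->
  exists G : I -> R, forall i j c,
    (forall eps, 0 < eps -> exists N, forall m, (N <= m)%N ->
      a i m <= a j m + c + eps) ->
    G i <= G j + c.
Proof.
move=> ab.
pose U i : set R := [set x | exists N, forall m, (N <= m)%N -> a i m <= x].
have Ulb i : has_lbound (U i).
  have [C aC] := ab i; exists (- C) => x [N Nx].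
  by have := Nx N (leqnn N); apply: le_trans; have := aC N; rewrite ler_norml => /andP[].
have U0 i : U i !=set0.
  have [C aC] := ab i; exists C, 0%N => m _.
  exact: le_trans (ler_norm _) (aC m).
exists (fun i => inf (U i)) => i j c H.
rewrite -lerBlDr; apply: lb_le_inf => // x [N Nx].
rewrite lerBlDr; apply/ler_addgt0Pr => eps eps0.
apply: ge_inf => //.
have [N' N'x] := H eps eps0.
exists (maxn N N') => m; rewrite geq_max => /andP[Nm N'm].
by rewrite (le_trans (N'x m N'm))// lerD2r lerD2r Nx.
Qed.

End upper_limit.

Section potential.
Variables (R : realType) (d : nat).
Local Notation E := 'rV[R]_d.
Variables (v : E -> E) (s : R).
Hypotheses (s0 : 0 < s) (s1 : s < 1).
Hypothesis v_upper :
  forall z z', s * dot (v z - v z') (z - z') <= sqnorm (z - z').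
Hypothesis v_lower :
  forall z z', - ((1 - s) * dot (v z - v z') (z - z')) <= sqnorm (z - z').

(** Left sums of the identity on [[0, 1]] stay below its integral; this is the source of the factor
    1/2 in the quadratic terms. *)
Let sum_fractions_le m :
  m.+1%:R^-1 * \sum_(0 <= k < m.+1) (k%:R / m.+1%:R) <= 2^-1 :> R.
Proof.
have H n : \sum_(0 <= k < n) k%:R <= n%:R ^+ 2 / 2 :> R.
  elim: n => [|n IH]; first by rewrite big_geq// expr0n/= mul0r.
  rewrite big_nat_recr//= -natr1; have : 0 <= n%:R :> R by [].
  by move: (\sum_(_ <= _ < _) _) (n%:R) IH => x y; rewrite !expr2; lra.
rewrite -mulr_suml mulrA ler_pdivrMr// ler_pdivrMl//.
by rewrite (le_trans (H m.+1))// mulrCA mulrC expr2.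
Qed.

Let slope_sum (f : nat -> R) (c q : R) m : 0 <= q ->
  (forall k, f k <= c + q * (k%:R / m.+1%:R)) ->
  m.+1%:R^-1 * \sum_(0 <= k < m.+1) f k <= c + q / 2.
Proof.
move=> q0 fc; have i0 : 0 <= m.+1%:R^-1 :> R by rewrite invr_ge0.
apply: (@le_trans _ _ (m.+1%:R^-1 * \sum_(0 <= k < m.+1) (c + q * (k%:R / m.+1%:R)))).
  by rewrite ler_wpM2l// ler_sum.
rewrite big_split /= sumr_const_nat subn0 mulrDr -[c *+ _]mulr_natl mulKf// lerD2l.
by rewrite -mulr_sumr mulrCA ler_wpM2l.
Qed.

(** Divide the one-sided monotonicity bound by [h]. The node with [h = 0] is treated apart: there
    [w] and [w'] coincide. *)
Let slope (c : R) (w w' : E) z z' h : 0 < c -> 0 <= h -> 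
  c * dot (w - w') (h *: (z' - z)) <= sqnorm (h *: (z' - z)) -> (h = 0 -> w = w') ->
  dot w (z' - z) <= dot w' (z' - z) + sqnorm (z' - z) / c * h.
Proof.
move=> c0; rewrite le_eqVlt => /predU1P[<- _ /(_ erefl)->|h0 + _].
  by rewrite mulr0 addr0.
move: (z' - z) => u; rewrite !sqnormE !dotE => H.
rewrite -lerBlDl -(ler_pM2l c0) -(ler_pM2l h0).
have -> : h * (c * (dot u u / c * h)) = h * (h * dot u u).
  by field; rewrite gt_eqF.
by move: H; lra.
Qed.

(** At the fraction [h] of the segment, the slope exceeds the initial one by at most
    [sqnorm (z' - z) / s * h]; then average over [h]. The lower bound is the same for [- v], with
    [1 - s]. *)
Lemma riemann_sum_upper z z' m :
  riemann_sum v z z' m <= dot (v z) (z' - z) + sqnorm (z' - z) / s / 2.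
Proof.
apply: slope_sum => [|k]; first by rewrite divr_ge0 ?sqnorm_ge0// ltW.
apply: slope => //.
- have := v_upper (node z z' m k) z.
  by rewrite /node [z + _]addrC addrK.
- by move=> k0; rewrite /node k0 scale0r addr0.
Qed.

Lemma riemann_sum_lower z z' m :
  dot (v z) (z' - z) - sqnorm (z' - z) / (1 - s) / 2 <= riemann_sum v z z' m.
Proof.
rewrite -[leRHS]opprK lerNr opprB addrC -mulrN -sumrN.
apply: slope_sum => [|k].
  by rewrite divr_ge0 ?sqnorm_ge0// subr_ge0 ltW.
rewrite -!dotNl; apply: slope; rewrite ?subr_gt0//.
- have := v_lower (node z z' m k) z.
  by rewrite /node [z + _]addrC addrK -mulrN -dotNl opprB opprK [v z - _]addrC.
- by move=> k0; rewrite /node k0 scale0r addr0.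
Qed.

Hypothesis triangle : forall z z' eps, 0 < eps ->
  exists N, forall m, (N <= m)%N ->
  `|riemann_sum v 0 z' m - riemann_sum v 0 z m - riemann_sum v z z' m| <= eps.

(* [G z] is the upper limit of the Riemann sums of [v] on the segment [0, z]. *)
Lemma potential_exists : exists G : E -> R, forall z z',
  G z' <= G z + dot (v z) (z' - z) + sqnorm (z' - z) / (2 * s) /\
  G z <= G z' - dot (v z) (z' - z) + sqnorm (z' - z) / (2 * (1 - s)).
Proof.
have [z|G HG] := @upper_limit_exists R E (riemann_sum v 0).
  pose y := dot (v 0) (z - 0) + sqnorm (z - 0) / s / 2.
  pose w := dot (v 0) (z - 0) - sqnorm (z - 0) / (1 - s) / 2.
  exists (`|y| + `|w|) => m.
  have := riemann_sum_upper 0 z m; have := riemann_sum_lower 0 z m.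
  rewrite -/y -/w; clearbody y w; move: (riemann_sum _ _ _ _) => x wx xy.
  have := ler_norm y; have := ler_norm (- w); rewrite normrN.
  have := normr_ge0 y; have := normr_ge0 w.
  by rewrite ler_norml => *; apply/andP; split; lra.
exists G => z z'; split.
  rewrite -addrA; apply: HG => eps eps0.
  (* The sum up to [z'] is, within [eps], the sum up to [z] plus that of the third side, which is
     bounded above. *)
  have [N HN] := triangle z z' eps0; exists N => m Nm.
  have := HN m Nm; rewrite ler_norml => /andP[_].
  have := riemann_sum_upper z z' m.
  rewrite [2 * s]mulrC invfM mulrA; clear.
  by move: (riemann_sum v 0 z' m) (riemann_sum v 0 z m) (riemann_sum v z z' m) (_ / 2) => *; lra.
rewrite -addrA; apply: HG => eps eps0.
have [N HN] := triangle z z' eps0; exists N => m Nm.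
have := HN m Nm; rewrite ler_norml => /andP[+ _].
have := riemann_sum_lower z z' m.
rewrite [2 * (1 - s)]mulrC invfM mulrA; clear.
by move: (riemann_sum v 0 z' m) (riemann_sum v 0 z m) (riemann_sum v z z' m) (_ / 2) => *; lra.
Qed.

End potential.

(** * Gradient approximations of the velocity *)

Section measurable_vectors.
Variables (R : realType) (d : nat) (dd : measure_display) (T : measurableType dd).
Local Notation E := 'rV[R]_d.

Lemma measurable_sqnorm : measurable_fun [set: E] (@sqnorm R d).
Proof.
apply: measurable_sum => i; apply: measurable_funX; exact: measurable_coord.
Qed.

Lemma measurable_rVB (f g : T -> E) : measurable_fun [set: T] f ->
  measurable_fun [set: T] g -> measurable_fun [set: T] (fun x => f x - g x).
Proof.
move=> mf mg; apply: measurable_fun_rV => i.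
rewrite [X in measurable_fun _ X](_ : _ = (fun x => f x 0 i - g x 0 i)).
  by apply: measurable_funB; exact: measurableT_comp (measurable_coord i) _.
by apply/funext => x; rewrite !mxE.
Qed.

Lemma measurable_sqnormB (f g : T -> E) : measurable_fun [set: T] f ->
  measurable_fun [set: T] g ->
  measurable_fun [set: T] (fun x => (sqnorm (f x - g x))%:E).
Proof.
move=> mf mg; apply/measurable_EFinP.
exact: measurableT_comp measurable_sqnorm (measurable_rVB mf mg).
Qed.

End measurable_vectors.

(** * Surjectivity of the interpolation on the support *)

Section surjectivity.
Variables (R : realType) (d : nat).
Local Notation E := 'rV[R]_d.
Local Notation EE := (E * E)%type.
Variables (gamma : probability EE R) (s : R).
Hypotheses (s0 : 0 < s) (s1 : s < 1).
Hypothesis mono : forall p q, supp gamma p -> supp gamma q ->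
  0 <= dot (p.1 - q.1) (p.2 - q.2).
Hypothesis dens : ac_inv_L1loc (interpolation gamma s).

(** By closedness of the image it suffices to meet every ball. A ball missed by the image of the
    support is null for the interpolated measure, whereas local integrability of the inverse density
    forbids null balls. *)
Lemma supp_interpolate_surjective z : exists2 p, supp gamma p & interpolate s p = z.
Proof.
apply: (interpolate_image_closed s0 s1 mono); first exact: closed_supp.
move=> r r0; apply: contrapT => noz.
have [_ [rho murho invK]] := dens.
pose B : set E := ball z r.
have mB : measurable B by apply: open_measurable_mx; exact: ball_open.
have muB0 : interpolation gamma s B = 0%E.
  have [N [mN N0 sN]] := supp_ae gamma.
  apply: (subset_measure0 _ mN _ N0).
    by rewrite -[X in measurable X]setTI; exact: measurable_interpolate.
  by move=> p Bp; apply: sN => /= sp; apply: noz; exists p.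
pose K := cube (d := d) (`|z| + r).
pose C := fine (\int[leb R d]_(x in K) ((rho x)%:E)^-1)%E.
have CE : (\int[leb R d]_(x in K) ((rho x)%:E)^-1)%E = C%:E.
  rewrite /C fineK// ge0_fin_numE; first exact: invK (@cube_compact R d _).
  apply: integral_ge0 => x _; rewrite inve_ge0 lee_fin.
  by case: murho.
have C0 : 0 <= C.
  rewrite -lee_fin -CE; apply: integral_ge0 => x _; rewrite inve_ge0 lee_fin.
  by case: murho.
(* In the bound for the indicator of [B] the term in [e^-1] vanishes, as [B] is null; a small [e]
   then contradicts the positive volume of [B]. *)
have lebB e : 0 < e -> (2 * r) ^+ d <= e * C.
  move=> e0; rewrite -lee_fin -(leb_ball z r0) EFinM -CE.
  have mI : measurable_fun setT (\1_B : E -> R) by exact: measurable_indic.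
  have := inverse_density_bound murho (measurable_cube (`|z| + r)) mI _ e0.
  rewrite integral_indic//; last exact: measurable_cube.
  rewrite setIidl; last first.
    move=> x; rewrite /B /cube -ball_normE /= => zx.
    have -> : x = z - (z - x) by rewrite opprB addrC subrK.
    by rewrite (le_trans (ler_normB _ _))// lerD2l ltW.
  move=> /(_ (fun x => ler0n _ _)) /le_trans; apply.
  under eq_integral.
    move=> x _; rewrite (_ : \1_B x ^+ 2 = \1_B x); last first.
      by rewrite indicE; case: (_ \in _); rewrite ?expr1n ?expr0n.
    over.
  by rewrite integral_indic// setIT [X in (_ * X + _)%E](_ : _ = 0%E)// mule0 add0e.
have p0 : 0 < (2 * r) ^+ d by rewrite exprn_gt0// mulr_gt0.
have e0 : 0 < (2 * r) ^+ d / (2 * (C + 1)) by rewrite divr_gt0// mulr_gt0// ltr_wpDl.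
have := lebB _ e0; rewrite leNgt => /negP; apply.
rewrite mulrAC ltr_pdivrMr ?mulr_gt0 ?ltr_wpDl// ltr_pM2l//; lra.
Qed.

End surjectivity.

(** * A time at which the loss vanishes *)

Section good_time.
Variables (R : realType) (d : nat).
Local Notation E := 'rV[R]_d.
Local Notation EE := (E * E)%type.
Variable gamma : probability EE R.
Local Open Scope ereal_scope.

Let defect (w : R -> E -> E) (p : measurableTypeR R * EE) : \bar R :=
  (sqnorm (w p.1 (interpolate p.1 p.2) - p.2.2 + p.2.1)%R)%:E.

Let D : set (measurableTypeR R * EE) := `[0%R, 1%R]%classic `*` [set: EE].

Let mD : measurable D.
Proof. by apply: measurableX => //; exact: measurable_itv. Qed.

Let measurable_defect w : velocity_field gamma w -> measurable_fun D (defect w).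
Proof.
move=> [mw _].
have mc (i : 'I_d) : measurable_fun [set: measurableTypeR R * EE]
    (fun p : measurableTypeR R * EE => p.2.1 0 i)%R.
  apply: measurableT_comp (measurable_coord i) _.
  exact: measurableT_comp measurable_fst measurable_snd.
have mc' (i : 'I_d) : measurable_fun [set: measurableTypeR R * EE]
    (fun p : measurableTypeR R * EE => p.2.2 0 i)%R.
  apply: measurableT_comp (measurable_coord i) _.
  exact: measurableT_comp measurable_snd measurable_snd.
have mI : measurable_fun [set: measurableTypeR R * EE]
    (fun p : measurableTypeR R * EE => (p.1, interpolate p.1 p.2)).
  apply: measurable_fun_pair; first exact: measurable_fst.
  apply: measurable_fun_rV => i.
  rewrite [X in measurable_fun _ X](_ : _ = (fun p : measurableTypeR R * EE =>
    (1 - p.1) * p.2.1 0 i + p.1 * p.2.2 0 i)%R); last first.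
    by apply/funext => p; rewrite !mxE.
  apply: measurable_funD; apply: measurable_funM => //.
  exact: measurable_funB.
have mwI : measurable_fun D
    (fun p : measurableTypeR R * EE => w p.1 (interpolate p.1 p.2)).
  have mF : measurable (`[0%R, 1%R]%classic `*` [set: E] : set (measurableTypeR R * E)).
    by apply: measurableX => //; exact: measurable_itv.
  apply: (measurable_comp mF _ mw (measurable_funTS mI)).
  by move=> _ [p [p1 _] <-].
apply/measurable_EFinP; apply: measurable_sum => i.
apply: measurable_funX.
rewrite [X in measurable_fun _ X](_ : _ = (fun p : measurableTypeR R * EE =>
    w p.1 (interpolate p.1 p.2) 0 i - p.2.2 0 i + p.2.1 0 i)%R); last first.
  by apply/funext => p; rewrite !mxE.
apply: measurable_funD; last exact: measurable_funTS.
apply: measurable_funB; last exact: measurable_funTS.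
exact: measurableT_comp (measurable_coord i) mwI.
Qed.

Lemma good_time_exists w : tangent_field gamma w -> loss w gamma = 0 ->
  exists t, tangent (interpolation gamma t) (w t) /\
    \int[gamma]_z (sqnorm (w t (interpolate t z) - z.2 + z.1)%R)%:E = 0.
Proof.
move=> [vw tw] lw.
(* The field is measurable for times in [[0, 1]] only; extension by 0 gives a function on the whole
   product, to which Tonelli applies. *)
pose f := defect w \_ D.
have mf : measurable_fun setT f.
  exact: ((measurable_restrictT (defect w) mD).1 (measurable_defect vw)).
have f0 p : 0 <= f p.
  by rewrite /f patchE; case: ifP => // _; rewrite lee_fin sqnorm_ge0.
have mF := @measurable_fun_fubini_tonelli_F _ _ _ _ R gamma f mf f0.
have FE t : t \in `[0%R, 1%R] -> fubini_F gamma f t =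
    \int[gamma]_z (sqnorm (w t (interpolate t z) - z.2 + z.1)%R)%:E.
  move=> t01; apply: eq_integral => z _.
  by rewrite /f patchE mem_set//.
have F0 : \int[@lebesgue_measure R]_(t in `[0%R, 1%R]) `|fubini_F gamma f t| = 0.
  rewrite -[RHS]lw; apply: eq_integral => t; rewrite inE /= => t01.
  by rewrite FE// gee0_abs// integral_ge0// => z _; rewrite lee_fin sqnorm_ge0.
have mFD : measurable_fun (`[0%R, 1%R]%classic : set (measurableTypeR R)) (fubini_F gamma f).
  exact: measurable_funTS.
have aeF := (ae_eq_integral_abs (@lebesgue_measure R) (measurable_itv _) mFD).1 F0.
apply: contrapT => nogood.
have [N [mN N0 sN]] := negligibleU tw aeF.
(* Without a good time, the null exceptional set would contain [[0, 1]]. *)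
have : @lebesgue_measure R `[0%R, 1%R] <= @lebesgue_measure R N.
  apply: le_measure; rewrite ?inE//.
  move=> t t01; apply: sN; apply: contrapT => /not_orP[/contrapT tt /contrapT Ft].
  apply: nogood; exists t; split; first exact: tt.
  by rewrite -FE//; exact: Ft.
by rewrite N0 lebesgue_measure_itv /= lte_fin ltr01 oppr0 adde0 lee_fin ler10.
Qed.

End good_time.

Section approximation.
Variables (R : realType) (d : nat).
Local Notation E := 'rV[R]_d.
Local Notation EE := (E * E)%type.
Variables (gamma : probability EE R) (s t : R) (v : E -> E).
Variable M : R.
Hypotheses (M0 : 0 < M) (vM : forall z z', `|v z - v z'| <= M * `|z - z'|).
Hypothesis v_supp : forall p, supp gamma p -> v (interpolate s p) = p.2 - p.1.
Hypothesis dens : ac_inv_L1loc (interpolation gamma s).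
Variable u : E -> E.
Hypothesis tan_u : tangent (interpolation gamma t) u.
Hypothesis u_opt :
  (\int[gamma]_z (sqnorm (u (interpolate t z) - z.2 + z.1)%R)%:E = 0)%E.

Let X z := z + (t - s) *: v z.

Let X_supp p : supp gamma p -> X (interpolate s p) = interpolate t p.
Proof.
move=> sp; rewrite /X v_supp// /interpolate.
by apply/rowP => i; rewrite !mxE; ring.
Qed.

Local Open Scope ereal_scope.

Let measurable_gradient (phi : E -> R) : test_function phi ->
  measurable_fun [set: E] (gradient phi).
Proof.
move=> [sphi _]; apply: measurable_fun_rV => i.
apply: continuous_measurable_rV.
under eq_fun do rewrite mxE.
by have [] := sphi [:: i].
Qed.

(** Both integrals are pulled back to [gamma]. On its support [v] is [y - x], and the error splits
    as [(u - v) - (u - gradient phi)], where the first part has zero integral by [u_opt]. *)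
Let error_bound (eps : R) (phi : E -> R) : test_function phi ->
  measurable_fun [set: E] (fun z => `|gradient phi (X z) - v z|)%R ->
  \int[interpolation gamma t]_x (sqnorm (u x - gradient phi x)%R)%:E
    < (eps ^+ 2)%:E ->
  \int[interpolation gamma s]_x (`|gradient phi (X x) - v x| ^+ 2)%:E <=
    (2 * eps ^+ 2)%:E.
Proof.
move=> tphi mg ltphi.
have [[mu _] _] := tan_u.
have mgr := measurable_gradient tphi.
have m1 : measurable_fun [set: EE]
    (fun z : EE => (sqnorm (u (interpolate t z) - z.2 + z.1)%R)%:E).
  rewrite [X in measurable_fun _ X](_ : _ = fun z : EE =>
    (sqnorm (u (interpolate t z) - (z.2 - z.1))%R)%:E); last first.
    by apply/funext => z; rewrite opprB addrA addrAC.
  apply: measurable_sqnormB; last exact: measurable_rVB.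
  exact: measurableT_comp mu (measurable_interpolate t).
have m2 : measurable_fun [set: EE]
    (fun z : EE => (sqnorm (u (interpolate t z) - gradient phi (interpolate t z))%R)%:E).
  apply: (measurable_sqnormB (f := u \o interpolate t)
    (g := gradient phi \o interpolate t));
    exact: measurableT_comp (measurable_interpolate t).
rewrite ge0_integral_distribution//; last first.
  by apply/measurable_EFinP; exact: measurable_funX.
apply: (@le_trans _ _ (\int[gamma]_z
  (2%:E * (sqnorm (u (interpolate t z) - z.2 + z.1)%R)%:E +
   2%:E * (sqnorm (u (interpolate t z) - gradient phi (interpolate t z))%R)%:E))).
  apply: ae_ge0_le_integral => //.
  - by move=> z _; rewrite lee_fin sqr_ge0.
  - apply/measurable_EFinP; apply: measurable_funX.
    exact: measurableT_comp mg (measurable_interpolate s).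
  - by move=> z _; rewrite adde_ge0// mule_ge0// lee_fin sqnorm_ge0.
  - by apply: emeasurable_funD; exact: emeasurable_funM.
  have := supp_ae gamma; apply: filterS => p sp _ /=.
  rewrite X_supp// v_supp// -!EFinM -EFinD lee_fin.
  rewrite (le_trans (norm_sq_le_sqnorm _))//.
  have -> : (gradient phi (interpolate t p) - (p.2 - p.1) =
    (u (interpolate t p) - p.2 + p.1) - (u (interpolate t p) - gradient phi (interpolate t p)))%R.
    by apply/rowP => i; rewrite !mxE; ring.
  exact: sqnormB_le.
rewrite ge0_integralD//; last 4 first.
- by move=> z _; rewrite mule_ge0// lee_fin sqnorm_ge0.
- exact: emeasurable_funM.
- by move=> z _; rewrite mule_ge0// lee_fin sqnorm_ge0.
- exact: emeasurable_funM.
rewrite !ge0_integralZl//; last 2 first.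
- by move=> z _; rewrite lee_fin sqnorm_ge0.
- by move=> z _; rewrite lee_fin sqnorm_ge0.
rewrite u_opt mule0 add0e EFinM lee_pmul2l//.
move: ltphi; rewrite ge0_integral_distribution//.
- exact: ltW.
- exact: measurable_sqnormB.
- by move=> x; rewrite lee_fin sqnorm_ge0.
Qed.

Lemma gradient_approximation (Q eta : R) : (0 < eta)%R -> exists phi : E -> R, [/\
  forall x i, derivable phi x (delta_mx 0%R i),
  forall i, continuous (fun x => gradient phi x 0 i)%R &
  \int[leb R d]_(x in cube Q) (`|gradient phi (X x) - v x|)%:E <= eta%:E].
Proof.
move=> eta0.
have [_ [rho murho invK]] := dens.
have rho0 : forall x, (0 <= rho x)%R by case: murho.
pose C := fine (\int[leb R d]_(x in cube (d := d) Q) ((rho x)%:E)^-1)%E.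
have C0' : 0 <= \int[leb R d]_(x in cube (d := d) Q) ((rho x)%:E)^-1.
  by apply: integral_ge0 => x _; rewrite inve_ge0 lee_fin.
have CE : \int[leb R d]_(x in cube (d := d) Q) ((rho x)%:E)^-1 = C%:E.
  by rewrite /C fineK// ge0_fin_numE//; exact: invK (@cube_compact R d _).
have C0 : (0 <= C)%R by rewrite -lee_fin -CE.
have C2 : (0 < 2 + C)%R by rewrite ltr_pwDl.
(* Chosen so that [eps^-1 * (2 * eps ^+ 2) + eps * C] equals [eta]. *)
pose eps := (eta / (2 + C))%R.
have eps0 : (0 < eps)%R by rewrite divr_gt0.
have [phi tphi ltphi] := tan_u.2 eps eps0.
have [sphi _] := tphi.
have cgrad i : continuous (fun x => gradient phi x 0 i)%R.
  under eq_fun do rewrite mxE.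
  by have [] := sphi [:: i].
exists phi; split => //; first by move=> x i; have [_] := sphi [::]; exact.
have mg : measurable_fun [set: E] (fun z => `|gradient phi (X z) - v z|)%R.
  exact: measurable_gradient_error M0 vM _ _ cgrad.
have g0 (x : E) : (0 <= `|gradient phi (X x) - v x|)%R by [].
apply: le_trans (inverse_density_bound murho (measurable_cube Q) mg g0 eps0) _.
rewrite CE -EFinM.
apply: (@le_trans _ _ (eps^-1%:E * (2 * eps ^+ 2)%:E + (eps * C)%:E)).
  rewrite leeD2r// lee_pmul2l ?lte_fin ?invr_gt0//.
  exact: error_bound.
rewrite -EFinM -EFinD lee_fin /eps le_eqVlt; apply/orP; left; apply/eqP.
by field; rewrite !gt_eqF.
Qed.

End approximation.

(** * Duality *)

Section marginals.
Variables (R : realType) (d : nat).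
Local Notation E := 'rV[R]_d.
Local Notation EE := (E * E)%type.
Variables (g g' : probability EE R) (pi : EE -> E).
Hypothesis mpi : measurable_fun [set: EE] pi.
Hypothesis eq_marginal :
  forall A, measurable A -> pushforward g pi A = pushforward g' pi A.
Local Open Scope ereal_scope.

Let ge0_integral_marginal (f : E -> \bar R) : measurable_fun [set: E] f ->
  (forall x, 0 <= f x) -> \int[g]_z f (pi z) = \int[g']_z f (pi z).
Proof.
move=> mf f0.
have := @ge0_integral_pushforward _ _ _ _ R _ mpi g setT f measurableT mf.
have := @ge0_integral_pushforward _ _ _ _ R _ mpi g' setT f measurableT mf.
rewrite preimage_setT => <- // <- //.
apply: eq_measure_integral => A mA _; exact: eq_marginal.
Qed.

(** Positive and negative parts are compared separately, so infinite values are allowed. *)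
Lemma integral_marginal (f : E -> \bar R) : measurable_fun [set: E] f ->
  \int[g]_z f (pi z) = \int[g']_z f (pi z).
Proof.
move=> mf; rewrite integralE [RHS]integralE; congr (_ - _).
  have -> : (fun z => f (pi z))^\+ = (fun z => f^\+ (pi z)).
    by apply/funext => z; rewrite !funeposE.
  by apply: ge0_integral_marginal => //; exact: measurable_funepos.
have -> : (fun z => f (pi z))^\- = (fun z => f^\- (pi z)).
  by apply/funext => z; rewrite !funenegE.
by apply: ge0_integral_marginal => //; exact: measurable_funeneg.
Qed.

Lemma integrable_marginal (f : E -> \bar R) : measurable_fun [set: E] f ->
  g.-integrable setT (f \o pi) -> g'.-integrable setT (f \o pi).
Proof.
move=> mf /integrableP[_ fi]; apply/integrableP; split.
  exact: measurableT_comp mf mpi.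
rewrite -(ge0_integral_marginal (f := abse \o f))//.
  exact: measurableT_comp.
by move=> x; exact: abse_ge0.
Qed.

End marginals.

(** The index type may be uncountable: the supremum is lower semicontinuous, its strict superlevel
    sets being unions of open sets. *)
Lemma measurable_sup_continuous (R : realType) d (I : Type)
    (F : I -> 'rV[R]_d -> R) : (forall i, continuous (F i)) ->
  measurable_fun [set: 'rV[R]_d] (fun x => ereal_sup [set (F i x)%:E | i in setT]).
Proof.
move=> cF; apply: (measurability _ (ErealGenOInfty.measurableE R)).
move=> /= _ [_ [a ->]] <-; rewrite setTI; apply: open_measurable_mx.
rewrite preimage_itvoy.
rewrite (_ : mkset _ = \bigcup_(i in setT) (F i @^-1` `]a, +oo[%classic)).
  apply: bigcup_open => i _; apply: open_comp; last exact: interval_open.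
  by move=> x _; exact: cF.
apply/seteqP; split=> [x /= /ereal_sup_gt[_ [i _ <-]]|x [i _]] /=.
  by rewrite lte_fin => aF; exists i => //=; rewrite in_itv /= andbT.
rewrite in_itv /= andbT => aF; apply: (@lt_le_trans _ _ (F i x)%:E).
  by rewrite lte_fin.
by apply: ereal_sup_ubound; exists i.
Qed.

Lemma continuous_sqnormB (R : realType) d (z : 'rV[R]_d) :
  continuous (fun x : 'rV[R]_d => sqnorm (x - z)).
Proof.
have -> : (fun x : 'rV[R]_d => sqnorm (x - z)) =
    \sum_(i < d) (fun x : 'rV[R]_d => (x 0 i - z 0 i) ^+ 2).
  by apply/funext => x; rewrite fct_sumE; apply: eq_bigr => i _; rewrite !mxE.
elim/big_ind: _ => [x|f g cf cg x|i _ x].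
- exact: cst_continuous.
- exact: continuousD (cf x) (cg x).
apply: (@continuous_comp _ _ _ (fun x : 'rV[R]_d => x 0 i - z 0 i) (fun y : R => y ^+ 2)).
  apply: (@continuousB _ _ _ (fun x : 'rV[R]_d => x 0 i) (cst (z 0 i))).
    exact: coord_continuous.
  exact: cst_continuous.
exact: exprn_continuous.
Qed.

Lemma continuous_paraboloid (R : realType) d (a c : R) (z : 'rV[R]_d) :
  continuous (fun x : 'rV[R]_d => a - sqnorm (x - z) / c).
Proof.
move=> x; apply: (@continuousB _ _ _ (cst a)
  (fun x : 'rV[R]_d => sqnorm (x - z) / c)); first exact: cst_continuous.
apply: (@continuousM _ _ (fun x : 'rV[R]_d => sqnorm (x - z)) (cst c^-1)).
  exact: continuous_sqnormB.
exact: cst_continuous.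
Qed.

(** Each of [f0] and [f1] is bounded below directly, and above through the relation with the other.
    Here [g] stands for [G 0], [a] and [b] for squared norms, [k] and [l] for [1 / s] and
    [1 / (1 - s)]. *)
Lemma dual_pair_bound (R : realType) (a b k l c g f0 f1 : R) :
  0 <= a -> 0 <= b -> 0 <= k -> 0 <= l -> 0 <= c ->
  2 * g - a * k <= f0 -> - (2 * g) - b * l <= f1 -> f0 + f1 + c = 0 ->
  `|f0| <= (2 * `|g| + (k + l)) * (1 + (a + b)) /\
  `|f1| <= (2 * `|g| + (k + l)) * (1 + (a + b)).
Proof.
move=> a0 b0 k0 l0 c0 h0 h1 h.
have := ler_norm g; have := ler_norm (- g); have := normr_ge0 g; rewrite normrN.
move: `|g| => n n0 gn gn'.
have := mulr_ge0 a0 k0; have := mulr_ge0 b0 k0.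
have := mulr_ge0 a0 l0; have := mulr_ge0 b0 l0.
have := mulr_ge0 a0 n0; have := mulr_ge0 b0 n0.
by move=> *; rewrite !ler_norml; split; apply/andP; split; lra.
Qed.

Section duality.
Variables (R : realType) (d : nat).
Local Notation E := 'rV[R]_d.
Local Notation EE := (E * E)%type.
Variables (mu0 mu1 : probability E R) (gamma : probability EE R).
Hypothesis cgamma : coupling mu0 mu1 gamma.
Variables (s : R) (v : E -> E) (G : E -> R).
Hypotheses (s0 : 0 < s) (s1 : s < 1).
Hypothesis v_supp : forall p, supp gamma p -> v (interpolate s p) = p.2 - p.1.
Hypothesis G_semiconvex : forall z z',
  G z' <= G z + dot (v z) (z' - z) + sqnorm (z' - z) / (2 * s) /\
  G z <= G z' - dot (v z) (z' - z) + sqnorm (z' - z) / (2 * (1 - s)).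

Let F0 z x := 2 * G z - sqnorm (x - z) / s.
Let F1 z y := - (2 * G z) - sqnorm (y - z) / (1 - s).
(* Kantorovich potentials (up to sign and to a factor 2): the Hopf-Lax
   evolutions of [G] from time [s] backwards to time 0 and forwards to time 1. *)
Let psi0 x := ereal_sup [set (F0 z x)%:E | z in [set: E]].
Let psi1 y := ereal_sup [set (F1 z y)%:E | z in [set: E]].

Let t0 : 0 < 1 - s. Proof. by rewrite subr_gt0. Qed.

Let mpsi0 : measurable_fun [set: E] psi0.
Proof.
by apply: measurable_sup_continuous => z; exact: continuous_paraboloid.
Qed.

Let mpsi1 : measurable_fun [set: E] psi1.
Proof.
by apply: measurable_sup_continuous => z; exact: continuous_paraboloid.
Qed.

Local Open Scope ereal_scope.

Let psi0_ge x z : (F0 z x)%:E <= psi0 x.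
Proof. by apply: ereal_sup_ubound; exists z. Qed.

Let psi1_ge x z : (F1 z x)%:E <= psi1 x.
Proof. by apply: ereal_sup_ubound; exists z. Qed.

(** Test both suprema at the same point [z] of the segment from [x] to [y]: the values of [G]
    cancel, and the quadratic terms add up to minus the cost. *)
Let duality_ge (p : EE) : 0 <= psi0 p.1 + psi1 p.2 + (sqnorm (p.1 - p.2)%R)%:E.
Proof.
case: p => x y /=.
pose z := interpolate s (x, y).
apply: (@le_trans _ _ ((F0 z x)%:E + (F1 z y)%:E + (sqnorm (x - y)%R)%:E)).
  rewrite -!EFinD lee_fin /F0 /F1.
  have -> : (x - z = s *: (x - y))%R.
    by apply/rowP => i; rewrite !mxE /=; ring.
  have -> : (y - z = - (1 - s) *: (x - y))%R.
    by apply/rowP => i; rewrite !mxE /=; ring.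
  rewrite !sqnormE !(dotZl, dotZr) le_eqVlt; apply/orP; left; apply/eqP.
  by field; rewrite !gt_eqF.
by rewrite leeD2r// leeD.
Qed.

(** As [x = z - s v(z)] and [y = z + (1 - s) v(z)], expanding the squares turns maximality of [z] in
    the two suprema into the two inequalities on [G]. *)
Let psi_supp (p : EE) : supp gamma p ->
  psi0 p.1 = (F0 (interpolate s p) p.1)%:E /\
  psi1 p.2 = (F1 (interpolate s p) p.2)%:E.
Proof.
move=> sp; set z := interpolate s p.
have x_z : (p.1 - z = - (s *: v z))%R.
  by rewrite v_supp//; apply/rowP => i; rewrite !mxE; ring.
have y_z : (p.2 - z = (1 - s) *: v z)%R.
  by rewrite v_supp//; apply/rowP => i; rewrite !mxE; ring.
split; apply/eqP; rewrite eq_le ?psi0_ge ?psi1_ge andbT; apply: ub_ereal_sup => _ [z' _ <-].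
  rewrite lee_fin /F0 -(subr0 (p.1 - z')) -(subrr z).
  have -> : (p.1 - z' - (z - z) = (p.1 - z) - (z' - z))%R.
    by apply/rowP => i; rewrite !mxE; ring.
  rewrite x_z; have [+ _] := G_semiconvex z z'.
  move: (z' - z)%R => u; rewrite !sqnormE !dotE.
  rewrite (dotC u (v z)) -(ler_pM2r s0) => h.
  have : (G z' * s <= G z * s + dot (v z) u * s + dot u u / 2)%R.
    apply: le_trans h _; rewrite le_eqVlt; apply/orP; left; apply/eqP.
    by field; rewrite gt_eqF.
  move=> h'; rewrite -(ler_pM2r s0) !mulrBl !divfK ?gt_eqF//; lra.
rewrite lee_fin /F1 -(subr0 (p.2 - z')) -(subrr z).
have -> : (p.2 - z' - (z - z) = (p.2 - z) - (z' - z))%R.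
  by apply/rowP => i; rewrite !mxE; ring.
rewrite y_z; have [_] := G_semiconvex z z'.
move: (z' - z)%R => u; rewrite !sqnormE !dotE.
rewrite (dotC u (v z)) -(ler_pM2r t0) => h.
have : (G z * (1 - s) <= G z' * (1 - s) - dot (v z) u * (1 - s) + dot u u / 2)%R.
  apply: le_trans h _; rewrite le_eqVlt; apply/orP; left; apply/eqP.
  by field; rewrite gt_eqF.
move=> h'; rewrite -(ler_pM2r t0) !mulrBl !divfK ?gt_eqF//; lra.
Qed.

Let duality_supp (p : EE) : supp gamma p ->
  psi0 p.1 + psi1 p.2 + (sqnorm (p.1 - p.2)%R)%:E = 0.
Proof.
move=> sp; have [-> ->] := psi_supp sp; rewrite -!EFinD; congr EFin.
set z := interpolate s p; rewrite /F0 /F1.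
have -> : (p.1 - z = s *: (p.1 - p.2))%R.
  by apply/rowP => i; rewrite !mxE /=; ring.
have -> : (p.2 - z = - (1 - s) *: (p.1 - p.2))%R.
  by apply/rowP => i; rewrite !mxE /=; ring.
rewrite !sqnormE !(dotZl, dotZr).
by field; rewrite !gt_eqF.
Qed.

Let K : R := (2 * `|G 0| + (s^-1 + (1 - s)^-1))%R.

(** Quadratic growth, hence integrability by the second moments: the suprema are tested at [z = 0],
    and equality in the duality bounds them from above. *)
Let psi_bound (p : EE) : supp gamma p ->
  `|psi0 p.1| <= (K * (1 + (sqnorm p.1 + sqnorm p.2)))%:E /\
  `|psi1 p.2| <= (K * (1 + (sqnorm p.1 + sqnorm p.2)))%:E.
Proof.
move=> sp; have := duality_supp sp; have := psi0_ge p.1 0%R; have := psi1_ge p.2 0%R.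
have [-> ->] := psi_supp sp; rewrite -!EFinD !lee_fin.
move: (F0 (interpolate s p) p.1) (F1 (interpolate s p) p.2) => f0 f1.
rewrite /F0 /F1 !subr0 => h1 h0 [h].
have is0 : (0 <= s^-1)%R by rewrite invr_ge0 ltW.
have it0 : (0 <= (1 - s)^-1)%R by rewrite invr_ge0 ltW.
exact: dual_pair_bound (sqnorm_ge0 _) (sqnorm_ge0 _) is0 it0 (sqnorm_ge0 _) h0 h1 h.
Qed.

Let integrable_moment (g : probability EE R) : coupling mu0 mu1 g ->
  g.-integrable setT (fun z => (sqnorm z.1 + sqnorm z.2)%:E).
Proof.
move=> [m2 _ _]; apply/integrableP; split.
  apply/measurable_EFinP; apply: measurable_funD.
    exact: measurableT_comp (@measurable_sqnorm R d) measurable_fst.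
  exact: measurableT_comp (@measurable_sqnorm R d) measurable_snd.
by under eq_integral do rewrite gee0_abs ?lee_fin ?addr_ge0 ?sqnorm_ge0//.
Qed.

Let integrable_cost (g : probability EE R) : coupling mu0 mu1 g ->
  g.-integrable setT (fun z => (sqnorm (z.1 - z.2)%R)%:E).
Proof.
move=> cg; have := integrableZl measurableT 2%R (integrable_moment cg).
apply: le_integrable => //.
  exact: measurable_sqnormB.
move=> z _ /=; rewrite lee_fin (ger0_norm (sqnorm_ge0 _)).
by rewrite (le_trans _ (ler_norm _))// mulrDr sqnormB_le.
Qed.

Let integrable_bound :
  gamma.-integrable setT (fun p => (K * (1 + (sqnorm p.1 + sqnorm p.2)))%:E).
Proof.
have -> : (fun p : EE => (K * (1 + (sqnorm p.1 + sqnorm p.2)))%:E) =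
  (fun p => K%:E * ((cst 1%:E \+ (fun z : EE => (sqnorm z.1 + sqnorm z.2)%:E)) p)).
  by apply/funext => p /=.
apply: integrableZl => //; apply: integrableD => //.
  exact: finite_measure_integrable_cst.
exact: integrable_moment.
Qed.

Let integrable_of_bound (f : EE -> \bar R) : measurable_fun setT f ->
  (forall p, supp gamma p -> `|f p| <= (K * (1 + (sqnorm p.1 + sqnorm p.2)))%:E) ->
  gamma.-integrable setT f.
Proof.
move=> mf fK; apply/integrableP; split => //.
have /integrableP[mb ib] := integrable_bound; apply: le_lt_trans ib.
apply: ae_ge0_le_integral => //; [exact: measurableT_comp|exact: measurableT_comp|].
have := supp_ae gamma; apply: filterS => p sp _.
by rewrite (le_trans (fK p sp))// lee_abs.
Qed.

Let ipsi0 : gamma.-integrable setT (psi0 \o fst).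
Proof.
apply: integrable_of_bound; first exact: measurableT_comp mpsi0 measurable_fst.
by move=> p /psi_bound[].
Qed.

Let ipsi1 : gamma.-integrable setT (psi1 \o snd).
Proof.
apply: integrable_of_bound; first exact: measurableT_comp mpsi1 measurable_snd.
by move=> p /psi_bound[].
Qed.

Lemma optimal_of_potential : optimal mu0 mu1 gamma.
Proof.
split=> // g' cg'.
have [_ g1 g2] := cgamma; have [_ g1' g2'] := cg'.
have e1 A : measurable A -> pushforward gamma fst A = pushforward g' fst A.
  by move=> mA; rewrite g1// g1'.
have e2 A : measurable A -> pushforward gamma snd A = pushforward g' snd A.
  by move=> mA; rewrite g2// g2'.
(* The growth bounds hold on the support of [gamma] only; integrability for the competitor comes
   from the equality of marginals. *)
have i0' := integrable_marginal measurable_fst e1 mpsi0 ipsi0.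
have i1' := integrable_marginal measurable_snd e2 mpsi1 ipsi1.
have sum g : coupling mu0 mu1 g -> g.-integrable setT (psi0 \o fst) ->
    g.-integrable setT (psi1 \o snd) ->
  \int[g]_z (psi0 z.1 + psi1 z.2 + (sqnorm (z.1 - z.2)%R)%:E) =
  \int[g]_z psi0 z.1 + \int[g]_z psi1 z.2 + cost g.
  move=> cg i0 i1.
  rewrite (integralD measurableT (integrableD measurableT i0 i1) (integrable_cost cg)).
  by rewrite (integralD measurableT i0 i1).
have S0 : \int[gamma]_z psi0 z.1 + \int[gamma]_z psi1 z.2 + cost gamma = 0.
  rewrite -sum// -[RHS](integral0 gamma setT); apply: ae_eq_integral => //.
    apply: emeasurable_funD; last exact: measurable_sqnormB.
    apply: emeasurable_funD.
      exact: measurableT_comp mpsi0 measurable_fst.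
    exact: measurableT_comp mpsi1 measurable_snd.
  have := supp_ae gamma; apply: filterS => p sp _; exact: duality_supp.
have S1 : 0 <= \int[gamma]_z psi0 z.1 + \int[gamma]_z psi1 z.2 + cost g'.
  rewrite (integral_marginal measurable_fst e1 mpsi0).
  rewrite (integral_marginal measurable_snd e2 mpsi1).
  by rewrite -sum//; apply: integral_ge0 => p _; exact: duality_ge.
have f0 := integrable_fin_num measurableT ipsi0.
have f1 := integrable_fin_num measurableT ipsi1.
(* The potentials contribute the same amount for both plans; it is finite, hence can be
   cancelled. *)
move: S1; rewrite -S0 leeD2lE//.
by rewrite fin_numD f0.
Qed.

End duality.

(** * Optimality of the plan from zero loss *)

Theorem theorem16 (R : realType) (d N : nat) (hN : (2 <= N)%N)
    (mu0 mu1 : probability 'rV[R]_d R)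
    (hmu0 : P2 mu0) (hmu1 : P2 mu1)
    (hac0 : ac_Linfty mu0) (hac1 : ac_Linfty mu1)
    (gamma : probability ('rV[R]_d * 'rV[R]_d)%type R)
    (hgamma : coupling mu0 mu1 gamma)
    (hcm : cyclically_monotone N gamma)
    (hmin : is_min (tangent_field gamma) (fun w => loss w gamma) 0%E)
    (ht : exists t : R, [/\ 0 < t, t < 1 & ac_inv_L1loc (interpolation gamma t)]) :
  optimal mu0 mu1 gamma.
Proof.
have [s [s0 s1 dens]] := ht.
have mono := cyclically_monotone_dot hN hcm.
have surj := supp_interpolate_surjective s0 s1 mono dens.
have [v [v_supp [M M0 vM] v_upper v_lower]] := velocity_exists s0 s1 mono surj.
have [[w tw lw] _] := hmin.
(* The time [t] bears no relation to [s]; the next steps use the displacement [tau = t - s], of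
   either sign. *)
have [t [tan_w w_opt]] := good_time_exists tw lw.
have approx := gradient_approximation M0 vM v_supp dens tan_w w_opt.
have triangle := riemann_triangle M0 vM approx.
have [G HG] := potential_exists s0 s1 v_upper v_lower triangle.
exact: (optimal_of_potential hgamma s0 s1 v_supp HG).
Qed.
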